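(* Let $N$ be an odd positive integer and, for $|q|<1$, let $$F_N(q):=\prod_{n=1}^{\infty}\frac{1}{\left(1-q^{n^N}\right)^{n^{2N-1}}}.$$ Then there is a constant $c$ (possibly depending on $N$) such that for every non-negative integer $r$, as $q \to 1^{-}$, $$F_N(q) = e^c (\log q)^{\frac{B_{2N}}{2N}}\exp\left(\frac{\zeta(3)}{N\log^2 q}\right) \exp\left( - \sum_{j=1}^{r+1} \delta_j (\log q)^{2j}\right)\left(1+ O_r\left((\log q)^{2r+4} \right)\right),$$ where $$\delta_j := \frac{2 \, \Gamma(2N+2Nj) \, \zeta(2N+2Nj) \, \zeta(2j)}{(2\pi)^{2N}\, j \left( (2\pi)^{N+1} \right)^{2j}}.$$
   Context: $B_{2N}$ is a Bernoulli number and $\zeta$ is the Riemann zeta function. Here $q\to1^-$ through real values $0<q<1$, $\log q<0$ is the real logarithm, and the power $(\log q)^{B_{2N}/(2N)}$ of the negative real number $\log q$ is taken with the principal branch, so that $c$ is in general a complex constant (it absorbs the constant phase). *)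

(* Defs.v *)
From Stdlib Require Import Reals Factorial Lra Lia.
From Coquelicot Require Import Coquelicot.
Open Scope R_scope.

Definition Cexp (z : C) : C :=
  (exp (Re z) * cos (Im z), exp (Re z) * sin (Im z)).

(* Principal argument, in (-PI, PI]; meaningful for z <> 0. *)
Definition Carg (z : C) : R :=
  if Rle_dec 0 (Im z) then acos (Re z / Cmod z) else - acos (Re z / Cmod z).

Definition Clog (z : C) : C := (ln (Cmod z), Carg z).

(* Principal branch of z^a; meaningful for z <> 0. *)
Definition Cpower (z a : C) : C := Cexp (a * Clog z).

(* [bernoulli_upto n k] is B_k for k <= n, computed from B_0 = 1 and
   sum_(0 <= k <= n) binom(n+1, k) B_k = 0 for n >= 1. *)
Fixpoint bernoulli_upto (n : nat) : nat -> R :=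
  match n with
  | O => fun _ => 1
  | S m => fun k =>
      if (k <=? m)%nat then bernoulli_upto m k
      else - sum_n (fun i => Binomial.C (S n) i * bernoulli_upto m i) m
           / INR (S n)
  end.

Definition bernoulli (n : nat) : R := bernoulli_upto n n.

Lemma bernoulli_uptoE (n k : nat) :
  (k <= n)%nat -> bernoulli_upto n k = bernoulli k.
Proof.
induction n as [|n IH]; intros Hk.
- now replace k with 0%nat by lia.
- destruct (Nat.eq_dec k (S n)) as [->|Hne]; [reflexivity|].
  cbn [bernoulli_upto].
  rewrite (proj2 (Nat.leb_le k n)) by lia.
  apply IH; lia.
Qed.

Lemma bernoulli_rec (n : nat) :
  (1 <= n)%nat ->
  sum_n (fun k => Binomial.C (S n) k * bernoulli k) n = 0.
Proof.
intros Hn; destruct n as [|m]; [lia|].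
rewrite sum_Sn.
assert (HB : bernoulli (S m) =
  - sum_n (fun i => Binomial.C (S (S m)) i * bernoulli i) m / INR (S (S m))).
{ unfold bernoulli at 1; cbn [bernoulli_upto].
  rewrite (proj2 (Nat.leb_gt (S m) m)) by lia.
  do 2 f_equal; apply sum_n_ext_loc; intros i Hi.
  now rewrite bernoulli_uptoE. }
assert (HC : Binomial.C (S (S m)) (S m) = INR (S (S m))).
{ unfold Binomial.C.
  replace (S (S m) - S m)%nat with 1%nat by lia.
  change (fact (S (S m))) with (S (S m) * fact (S m))%nat.
  rewrite mult_INR; simpl (fact 1); simpl (INR 1); field.
  apply INR_fact_neq_0. }
rewrite HB, HC; unfold plus; cbn -[INR sum_n Binomial.C].
field; apply not_0_INR; lia.
Qed.

(* Dirichlet series of the Riemann zeta function, used only for s >= 2. *)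
Definition zeta (s : R) : R := Series (fun n => / Rpower (INR (S n)) s).

(* Euler's integral, used only for x > 0. *)
Definition Gamma (x : R) : R :=
  RInt_gen (fun t => Rpower t (x - 1) * exp (- t))
           (at_right 0) (Rbar_locally p_infty).

Fixpoint Cprod (f : nat -> C) (n : nat) : C :=
  match n with
  | O => 1
  | S m => (Cprod f m * f m)%C
  end.

(* The limit of the partial products prod_(1 <= n <= M) f n. *)
Definition Cprod_inf (f : nat -> C) : C :=
  @lim C_R_CompleteNormedModule
    (filtermap (Cprod (fun k => f (S k))) eventually).

Definition F (N : nat) (q : C) : C :=
  Cprod_inf (fun n => (1 / (1 - q ^ (n ^ N)) ^ (n ^ (2 * N - 1)))%C).

Definition delta (N j : nat) : R :=
  2 * Gamma (INR (2 * N + 2 * N * j)) * zeta (INR (2 * N + 2 * N * j))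
    * zeta (INR (2 * j))
  / ((2 * PI) ^ (2 * N) * INR j * ((2 * PI) ^ (N + 1)) ^ (2 * j)).

Definition is_bigO (G : (R -> Prop) -> Prop) (f : R -> C) (g : R -> R) : Prop :=
  exists K : R, G (fun x => Cmod (f x) <= K * Rabs (g x)).

(* Main.v *)
(** With [q = exp (- x)] the logarithm of the product is
    [L x = sum_n n^(2N-1) (- ln (1 - exp (- n^N x)))]. Its singularity at [x = 0]
    is logarithmic, but with [x = y^N] its derivative is
    [L' x = - y^(1-3N) sum_n h (n y)] for the function
    [h t = t^(3N-1) / (exp (t^N) - 1)], which is smooth on the whole line and
    rapidly decreasing with all its derivatives. Euler-Maclaurin summation
    therefore expands [L'] to every order, and integration gives [L] up to the
    constant [c].

    The Euler-Maclaurin kernels are taken as Fourier series, so that the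
    coefficients are values of [zeta] at even integers, and those at odd indices
    vanish. Applying the same formula to [exp (- t)], whose sum over multiples of
    [y] is [1 / (exp y - 1)], identifies these values with Bernoulli numbers and at
    the same time yields the Taylor coefficients of [h]. *)

Require Import Defs.
From Stdlib Require Import Reals Ranalysis5 Factorial Wf_nat Lra Lia.
From Coquelicot Require Import Coquelicot.
Open Scope R_scope.

(* Coquelicot lemmas leave equations typed in a structure whose carrier is [R],
   on which [ring] and [field] fail. *)
Ltac real_eq := match goal with |- ?a = ?b => change (a = b :> R) end.

(** * Series and comparison of increments *)

(** The oddness of [N] enters twice: the power x^k of the expansion of L carries the factor
    [kernel (N * (k + 2)) 0], which vanishes for odd k because N (k + 2) is then odd, and the same
    parity fixes the sign of every delta_j. The two zeta values in delta_j have different origins: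
    zeta(2N + 2Nj) is a kernel value from Euler-Maclaurin, zeta(2j) a Taylor coefficient of h. The
    term in zeta(3) is the integral of h over the half-line, which u = t^N turns into 1/N times the
    integral of u^2 / (exp u - 1). The exponent B_2N / (2N) is the coefficient of 1/x in L'. The
    price of Fourier kernels is paid at the lowest index: the series of [kernel 2] cannot be
    differentiated termwise by domination, so its sawtooth derivative is obtained from the Dirichlet
    kernel. For 0 < q < 1 the product is a positive real, whereas the principal power of log q has
    the constant phase exp(i pi B_2N / (2N)); the imaginary part of c cancels it. *)

Lemma increment_le (f df g dg : R -> R) (a b : R) :
  a <= b ->
  (forall t, a < t < b -> is_derive f t (df t)) ->
  (forall t, a < t < b -> is_derive g t (dg t)) ->
  (forall t, a <= t <= b -> continuous f t) ->
  (forall t, a <= t <= b -> continuous g t) ->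
  (forall t, a < t < b -> Rabs (df t) <= dg t) ->
  Rabs (f b - f a) <= g b - g a.
Proof.
intros Hab Hf Hg Cf Cg Hd.
destruct (Req_dec a b) as [<-|Hne].
{ rewrite !Rminus_diag, Rabs_R0; lra. }
assert (Hlt : a < b) by lra.
assert (Hs : forall s, s = 1 \/ s = -1 -> 0 <= (g b - s * f b) - (g a - s * f a)).
{ intros s Hs.
  set (k := fun t => g t - s * f t).
  (* The mean value point may be an endpoint, where [Hd] says nothing; the value 0 there keeps the
     sign argument valid. *)
  set (dk := fun t => if Rle_dec t a then 0 else if Rle_dec b t then 0
                      else dg t - s * df t).
  destruct (MVT_gen k a b dk) as [c [Hc Heq]].
  - rewrite Rmin_left, Rmax_right by lra; intros t Ht.
    unfold dk; destruct (Rle_dec t a); [lra|]; destruct (Rle_dec b t); [lra|].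
    apply (is_derive_minus (V := R_NormedModule)); [apply Hg; lra|].
    apply (is_derive_scal f t s); apply Hf; lra.
  - rewrite Rmin_left, Rmax_right by lra; intros t Ht.
    apply continuity_pt_filterlim.
    apply (continuous_minus (V := R_NormedModule)); [now apply Cg|].
    apply (continuous_scal_r (V := R_NormedModule)); now apply Cf.
  - unfold k in Heq; rewrite Heq.
    apply Rmult_le_pos; [|lra].
    unfold dk; destruct (Rle_dec c a); [lra|]; destruct (Rle_dec b c); [lra|].
    assert (H := Hd c ltac:(lra)); apply Rabs_le_between in H.
    destruct Hs as [-> | ->]; lra. }
assert (H1 := Hs 1 ltac:(auto)); assert (H2 := Hs (-1) ltac:(auto)).
apply Rabs_le; lra.
Qed.

Lemma sum_n_S (a : nat -> R) (n : nat) : sum_n a (S n) = sum_n a n + a (S n).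
Proof. now rewrite sum_Sn. Qed.

Lemma ex_series_inv_sqr : ex_series (fun n => / INR (S n) ^ 2).
Proof.
apply (ex_series_le (K := R_AbsRing) (V := R_CompleteNormedModule) _
  (fun n => 2 * (/ INR (S n) - / INR (S (S n))))).
- intros n; unfold norm; simpl; unfold abs; simpl.
  assert (H := pos_INR n).
  change (match n with 0%nat => 1 | S _ => INR n + 1 end) with (INR (S n)).
  rewrite !S_INR, Rmult_1_r.
  rewrite Rabs_pos_eq by (left; apply Rinv_0_lt_compat; nra).
  apply Rminus_le_0.
  replace (2 * (/ (INR n + 1) - / (INR n + 1 + 1)) - / ((INR n + 1) * (INR n + 1)))
    with (INR n / ((INR n + 1) * (INR n + 1) * (INR n + 1 + 1))) by (field; lra).
  apply Rdiv_le_0_compat; nra.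
- exists 2.
  change (is_lim_seq (sum_n (fun n => 2 * (/ INR (S n) - / INR (S (S n))))) 2).
  apply is_lim_seq_ext with (fun n => 2 - 2 * / INR (S (S n))).
  + induction n as [|n IH].
    * rewrite sum_O; simpl; field.
    * rewrite sum_n_S, <- IH, !S_INR.
      assert (H := pos_INR n); field; lra.
  + replace (Finite 2) with (Finite (2 - 2 * 0)) by (f_equal; ring).
    apply (is_lim_seq_minus' _ _ 2 (2 * 0)); [apply is_lim_seq_const|].
    apply (is_lim_seq_scal_l _ 2 0).
    apply (is_lim_seq_ext (fun n => / INR (n + 2))).
    { intros n; do 2 f_equal; lia. }
    apply (is_lim_seq_incr_n (fun n => / INR n) 2 0).
    apply (is_lim_seq_inv INR p_infty); [apply is_lim_seq_INR | easy].
Qed.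

Lemma ex_series_dominated (a : nat -> R) (b : nat -> R) :
  (forall n, Rabs (a n) <= b n) -> ex_series b -> ex_series a.
Proof. exact (ex_series_le (K := R_AbsRing) (V := R_CompleteNormedModule) a b). Qed.

Lemma Series_dominated (a : nat -> R) (b : nat -> R) :
  (forall n, Rabs (a n) <= b n) -> ex_series b -> Rabs (Series a) <= Series b.
Proof.
intros Hab Hb.
apply Rle_trans with (Series (fun n => Rabs (a n))).
- apply Series_Rabs, (ex_series_dominated _ b); [|easy].
  now intros n; rewrite Rabs_Rabsolu.
- apply Series_le; [|easy]; intros n; split; [apply Rabs_pos|apply Hab].
Qed.

Lemma is_lim_seq_sum_n (a : nat -> R) :
  ex_series a -> is_lim_seq (sum_n a) (Series a).
Proof. exact (Series_correct a). Qed.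

Lemma Series_minus_sum_n (a : nat -> R) (n : nat) :
  ex_series a -> Series a - sum_n a n = Series (fun k => a (S n + k)%nat).
Proof.
intros Ha; rewrite (Series_incr_n a (S n)) by (lia || easy).
rewrite <- sum_n_Reals; cbn [Init.Nat.pred]; ring.
Qed.

(** The Weierstrass M-test. *)
Lemma CVU_dominated (f : nat -> R -> R) (A : nat -> R) (c : R) (r : posreal) :
  ex_series A ->
  (forall n t, Boule c r t -> Rabs (f n t) <= A n) ->
  CVU (fun n t => sum_n (fun k => f k t) n) (fun t => Series (fun k => f k t)) c r.
Proof.
intros HA Hf eps Heps.
assert (HL := is_lim_seq_sum_n A HA).
apply is_lim_seq_spec in HL.
destruct (HL (mkposreal eps Heps)) as [N HN]; simpl in HN.
exists N; intros n y Hn Hy.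
assert (Hex : ex_series (fun k => f k y)).
{ apply (ex_series_dominated _ A); [|easy]; intros k; now apply Hf. }
rewrite (Series_minus_sum_n _ n Hex).
apply Rle_lt_trans with (Series (fun k => A (S n + k)%nat)).
- apply Series_dominated; [intros k; now apply Hf|].
  now apply (ex_series_incr_n A (S n)).
- rewrite <- Series_minus_sum_n by easy.
  specialize (HN n Hn); rewrite Rabs_minus_sym in HN.
  eapply Rle_lt_trans; [apply Rle_abs|exact HN].
Qed.

Lemma continuous_sum_n (f : nat -> R -> R) (n : nat) (x : R) :
  (forall k, continuous (f k) x) -> continuous (fun t => sum_n (fun k => f k t) n) x.
Proof.
intros H; induction n as [|n IH].
- apply (continuous_ext (f 0%nat)); [intros t; now rewrite sum_O|apply H].
- apply (continuous_ext (fun t => plus (sum_n (fun k => f k t) n) (f (S n) t))).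
  { intros t; now rewrite sum_Sn. }
  now apply (continuous_plus (V := R_NormedModule)).
Qed.

Lemma continuous_Series (f : nat -> R -> R) (A : nat -> R) (x : R) (r : posreal) :
  ex_series A ->
  (forall n t, Boule x r t -> Rabs (f n t) <= A n) ->
  (forall n t, Boule x r t -> continuous (f n) t) ->
  forall t, Boule x r t -> continuous (fun t => Series (fun k => f k t)) t.
Proof.
intros HA Hf Hc t Ht.
apply continuity_pt_filterlim.
apply (CVU_continuity (fun n t => sum_n (fun k => f k t) n) _ x r); [| |easy].
- now apply (CVU_dominated f A).
- intros n y Hy; apply continuity_pt_filterlim, continuous_sum_n; intros k.
  now apply Hc.
Qed.

Lemma is_derive_Series (f f' : nat -> R -> R) (A : nat -> R) (x : R) (r : posreal) :
  ex_series A ->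
  (forall n t, Boule x r t -> is_derive (f n) t (f' n t)) ->
  (forall n t, Boule x r t -> continuous (f' n) t) ->
  (forall n t, Boule x r t -> Rabs (f' n t) <= A n) ->
  (forall t, Boule x r t -> ex_series (fun n => f n t)) ->
  is_derive (fun t => Series (fun n => f n t)) x (Series (fun n => f' n x)).
Proof.
intros HA Hd Hc Hb Hs.
apply is_derive_Reals.
apply (derivable_pt_lim_CVU (fun n t => sum_n (fun k => f k t) n)
  (fun n t => sum_n (fun k => f' k t) n) _
  (fun t => Series (fun k => f' k t)) x x r).
- unfold Boule; rewrite Rminus_diag, Rabs_R0; apply cond_pos.
- intros y n Hy; apply is_derive_Reals.
  apply (is_derive_sum_n f n y (fun k => f' k y)); intros k _; now apply Hd.
- intros y Hy; apply is_lim_seq_Reals, is_lim_seq_sum_n; now apply Hs.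
- now apply (CVU_dominated f' A).
- intros y Hy; apply continuity_pt_filterlim.
  now apply (continuous_Series f' A x r).
Qed.

(** * Periodic kernels *)

(* The Fourier phases of the kernels of index [m]: the derivative of
   [cyc (S m)] is [cyc m], with [cyc 2 = cos]. *)
Fixpoint cyc (m : nat) (t : R) : R :=
  match m with
  | O => - cos t
  | S O => - sin t
  | S (S k) => - cyc k t
  end.

Lemma is_derive_cyc (m : nat) (t : R) : is_derive (cyc (S m)) t (cyc m t).
Proof.
enough (H : is_derive (cyc (S m)) t (cyc m t) /\
            is_derive (cyc (S (S m))) t (cyc (S m) t)) by apply H.
induction m as [|m [IH1 IH2]].
- split; simpl; auto_derive; trivial; ring.
- split; [easy|].
  apply (is_derive_opp (V := R_NormedModule) (cyc (S m)) t (cyc m t) IH1).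
Qed.

Lemma continuous_cyc (m : nat) (t : R) : continuous (cyc m) t.
Proof.
destruct m as [|m].
- apply (ex_derive_continuous (K := R_AbsRing) (V := R_NormedModule)).
  simpl; auto_derive; trivial.
- apply (ex_derive_continuous (K := R_AbsRing) (V := R_NormedModule)).
  eexists; apply is_derive_cyc.
Qed.

Lemma cyc_bound (m : nat) (t : R) : Rabs (cyc m t) <= 1.
Proof.
enough (H : Rabs (cyc m t) <= 1 /\ Rabs (cyc (S m) t) <= 1) by apply H.
induction m as [|m [IH1 IH2]].
- simpl; rewrite !Rabs_Ropp; split; apply Rabs_le; [apply COS_bound|apply SIN_bound].
- split; [easy|]; simpl; now rewrite Rabs_Ropp.
Qed.

Lemma cyc_periodic (m k : nat) (t : R) :
  cyc m (t + 2 * INR k * PI) = cyc m t.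
Proof.
enough (H : cyc m (t + 2 * INR k * PI) = cyc m t /\
            cyc (S m) (t + 2 * INR k * PI) = cyc (S m) t) by apply H.
induction m as [|m [IH1 IH2]].
- simpl; now rewrite cos_period, sin_period.
- split; [easy|]; simpl; now rewrite IH1.
Qed.

Definition freq (n : nat) : R := 2 * PI * INR (S n).

(** For m >= 2 this is the Fourier series of the periodic Bernoulli function B_m({t}) / m!. *)
Definition kernel (m : nat) (t : R) : R :=
  Series (fun n => 2 * cyc m (freq n * t) / freq n ^ m).

Lemma freq_ge (n : nat) : INR (S n) <= freq n.
Proof.
unfold freq; assert (H := PI2_1); assert (H' := pos_INR (S n)).
unfold PI2 in H; nra.
Qed.

Lemma freq_pos (n : nat) : 0 < freq n.
Proof. eapply Rlt_le_trans; [|apply freq_ge]; apply lt_0_INR; lia. Qed.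

Lemma freq_pow_ge (m n : nat) : (2 <= m)%nat -> INR (S n) ^ 2 <= freq n ^ m.
Proof.
intros Hm.
assert (H1 : 1 <= INR (S n)) by (apply (le_INR 1); lia).
assert (H2 := freq_ge n).
apply Rle_trans with (freq n ^ 2); [apply pow_incr; lra|].
apply Rle_pow; [lra|easy].
Qed.

Lemma kernel_term_bound (m n : nat) (t : R) :
  (2 <= m)%nat -> Rabs (2 * cyc m t / freq n ^ m) <= 2 * / INR (S n) ^ 2.
Proof.
intros Hm.
assert (H0 := freq_pos n).
assert (H1 : 0 < INR (S n) ^ 2) by (apply pow_lt, lt_0_INR; lia).
unfold Rdiv; rewrite !Rabs_mult, (Rabs_pos_eq 2) by lra.
rewrite Rmult_assoc; apply Rmult_le_compat_l; [lra|].
rewrite (Rabs_pos_eq (/ _)) by (left; apply Rinv_0_lt_compat, pow_lt, H0).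
rewrite <- (Rmult_1_l (/ INR (S n) ^ 2)).
apply Rmult_le_compat; [apply Rabs_pos | | apply cyc_bound | ].
- left; apply Rinv_0_lt_compat, pow_lt, H0.
- apply Rinv_le_contravar; [easy | now apply freq_pow_ge].
Qed.

Lemma ex_series_kernel_bound : ex_series (fun n => 2 * / INR (S n) ^ 2).
Proof. exact (ex_series_scal_l 2 _ ex_series_inv_sqr). Qed.

Lemma ex_series_kernel (m : nat) (t : R) :
  (2 <= m)%nat -> ex_series (fun n => 2 * cyc m (freq n * t) / freq n ^ m).
Proof.
intros Hm.
apply (ex_series_dominated _ (fun n => 2 * / INR (S n) ^ 2)).
- intros n; now apply kernel_term_bound.
- apply ex_series_kernel_bound.
Qed.

Lemma continuous_kernel_term (m n : nat) (t : R) :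
  continuous (fun t => 2 * cyc m (freq n * t) / freq n ^ m) t.
Proof.
unfold Rdiv.
apply (continuous_mult (K := R_AbsRing)); [|apply continuous_const].
apply (continuous_scal_r (V := R_NormedModule) 2).
apply (continuous_comp (fun t => freq n * t) (cyc m)); [|apply continuous_cyc].
apply (continuous_scal_r (V := R_NormedModule)), continuous_id.
Qed.

(** Termwise differentiation is dominated by 2 / n^2 exactly as long as the differentiated series
    still has index at least 2. *)
Lemma is_derive_kernel (m : nat) (t : R) :
  (2 <= m)%nat -> is_derive (kernel (S m)) t (kernel m t).
Proof.
intros Hm; unfold kernel.
apply (is_derive_Series _ (fun n t => 2 * cyc m (freq n * t) / freq n ^ m)
  (fun n => 2 * / INR (S n) ^ 2) t (mkposreal 1 Rlt_0_1)).
- apply ex_series_kernel_bound.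
- intros n s _.
  assert (H := is_derive_comp (cyc (S m)) (fun t => freq n * t) s
    (cyc m (freq n * s)) (freq n) (is_derive_cyc m _)).
  assert (H1 : is_derive (fun t => freq n * t) s (freq n)).
  { auto_derive; trivial; ring. }
  specialize (H H1).
  apply (is_derive_scal _ _ (2 / freq n ^ S m)) in H.
  apply (is_derive_ext (fun x => 2 / freq n ^ S m * cyc (S m) (freq n * x))).
  { intros x; change (2 / freq n ^ S m * cyc (S m) (freq n * x)
      = 2 * cyc (S m) (freq n * x) / freq n ^ S m); unfold Rdiv; ring. }
  replace (2 * cyc m (freq n * s) / freq n ^ m)
    with (2 / freq n ^ S m * scal (freq n) (cyc m (freq n * s))); [exact H|].
  unfold scal; simpl; unfold mult; simpl.
  assert (Hf := freq_pos n); field; split; [|lra]; apply pow_nonzero; lra.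
- intros n s _; apply continuous_kernel_term.
- intros n s _; now apply kernel_term_bound.
- intros s _; apply ex_series_kernel; lia.
Qed.

Lemma continuous_kernel (m : nat) (t : R) : (2 <= m)%nat -> continuous (kernel m) t.
Proof.
intros Hm; unfold kernel.
apply (continuous_Series (fun n t => 2 * cyc m (freq n * t) / freq n ^ m)
  (fun n => 2 * / INR (S n) ^ 2) t (mkposreal 1 Rlt_0_1)).
- apply ex_series_kernel_bound.
- intros n s _; now apply kernel_term_bound.
- intros n s _; apply continuous_kernel_term.
- unfold Boule; rewrite Rminus_diag, Rabs_R0; simpl; lra.
Qed.

Definition kernel_sup : R := Series (fun n => 2 * / INR (S n) ^ 2).

Lemma kernel_bound (m : nat) (t : R) : (2 <= m)%nat -> Rabs (kernel m t) <= kernel_sup.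
Proof.
intros Hm; apply Series_dominated; [|apply ex_series_kernel_bound].
intros n; now apply kernel_term_bound.
Qed.

Lemma kernel_periodic (m k : nat) (t : R) : kernel m (INR k + t) = kernel m t.
Proof.
apply Series_ext; intros n; do 2 f_equal.
replace (freq n * (INR k + t)) with (freq n * t + 2 * INR (S n * k) * PI).
- now apply cyc_periodic.
- unfold freq; rewrite mult_INR; ring.
Qed.

Lemma kernel_INR (m k : nat) : kernel m (INR k) = kernel m 0.
Proof. now rewrite <- (kernel_periodic m k 0), Rplus_0_r. Qed.

(** * The derivative of [kernel 2] by means of the Dirichlet kernel *)

Lemma dirichlet_kernel (M : nat) (s : R) :
  2 * sin (PI * s) * sum_n (fun n => cos (freq n * s)) M
  = sin ((2 * INR M + 3) * PI * s) - sin (PI * s).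
Proof.
assert (step : forall n, 2 * sin (PI * s) * cos (freq n * s)
  = sin ((2 * INR n + 3) * PI * s) - sin ((2 * INR n + 1) * PI * s)).
{ intros n.
  replace ((2 * INR n + 3) * PI * s) with (freq n * s + PI * s)
    by (unfold freq; rewrite S_INR; ring).
  replace ((2 * INR n + 1) * PI * s) with (freq n * s - PI * s)
    by (unfold freq; rewrite S_INR; ring).
  rewrite sin_plus, sin_minus; ring. }
induction M as [|M IH].
- rewrite sum_O, step; f_equal; f_equal; simpl; ring.
- rewrite sum_n_S, Rmult_plus_distr_l, IH, step, S_INR.
  replace (2 * (INR M + 1) + 1) with (2 * INR M + 3) by ring; ring.
Qed.

(** Integration will run from the midpoint 1/2 to s; along this path the denominator is smallest at
    the end s, since the sine is monotone on each half of the interval. *)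
Lemma sin_PI_ge (s v : R) : 0 < s < 1 ->
  Rmin s (1 / 2) <= v <= Rmax s (1 / 2) -> 0 < sin (PI * s) <= sin (PI * v).
Proof.
intros Hs Hv; assert (HP := PI_RGT_0).
split; [apply sin_gt_0; nra|].
destruct (Rle_dec s (1 / 2)).
- rewrite Rmin_left, Rmax_right in Hv by lra.
  apply sin_incr_1; nra.
- rewrite Rmin_right, Rmax_left in Hv by lra.
  apply sin_decr_1; nra.
Qed.

(* [sawtooth_err M s] is the second antiderivative of the (normalised)
   Dirichlet kernel; integrating by parts once shows that its derivative is
   O(1/M) away from the integers. *)
Definition sawtooth_err (M : nat) (s : R) : R :=
  sum_n (fun n => 2 * cyc 2 (freq n * s) / freq n ^ 2) M - (s ^ 2 - s) / 2.

Definition sawtooth_err' (M : nat) (s : R) : R :=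
  sum_n (fun n => 2 * cyc 1 (freq n * s) / freq n) M - (s - 1 / 2).

Lemma is_derive_sawtooth_err (M : nat) (s : R) :
  is_derive (sawtooth_err M) s (sawtooth_err' M s).
Proof.
apply (is_derive_minus (V := R_NormedModule)).
- apply (is_derive_sum_n (fun n s => 2 * cyc 2 (freq n * s) / freq n ^ 2) M s
    (fun n => 2 * cyc 1 (freq n * s) / freq n)); intros n _.
  assert (Hf := freq_pos n); simpl; auto_derive; trivial; field; lra.
- auto_derive; trivial; field.
Qed.

Lemma is_derive_sawtooth_err' (M : nat) (s : R) : 0 < s < 1 ->
  is_derive (sawtooth_err' M) s (- sin ((2 * INR M + 3) * PI * s) / sin (PI * s)).
Proof.
intros Hs.
assert (Hsin : 0 < sin (PI * s)).
{ assert (HP := PI_RGT_0); apply sin_gt_0; nra. }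
replace (- sin ((2 * INR M + 3) * PI * s) / sin (PI * s))
  with (sum_n (fun n => -2 * cos (freq n * s)) M - 1).
- apply (is_derive_minus (V := R_NormedModule)).
  + apply (is_derive_sum_n (fun n s => 2 * cyc 1 (freq n * s) / freq n) M s
      (fun n => -2 * cos (freq n * s))); intros n _.
    assert (Hf := freq_pos n); simpl; auto_derive; trivial; field; lra.
  + auto_derive; trivial; field.
- assert (H := dirichlet_kernel M s).
  replace (sin ((2 * INR M + 3) * PI * s)) with
    (2 * sin (PI * s) * sum_n (fun n => cos (freq n * s)) M + sin (PI * s)) by lra.
  replace (sum_n (fun n => -2 * cos (freq n * s)) M)
    with (-2 * sum_n (fun n => cos (freq n * s)) M).
  + field; lra.
  + symmetry; apply (sum_n_mult_l (K := R_Ring)).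
Qed.

(** Makes the boundary term of the integration by parts vanish at the midpoint. *)
Lemma cos_half_odd (M : nat) : cos ((2 * INR M + 3) * PI * (1 / 2)) = 0.
Proof.
replace ((2 * INR M + 3) * PI * (1 / 2)) with (INR M * PI + 3 * (PI / 2)) by field.
induction M as [|M IH].
- simpl; rewrite Rmult_0_l, Rplus_0_l; apply cos_3PI2.
- replace (INR (S M) * PI + 3 * (PI / 2)) with (INR M * PI + 3 * (PI / 2) + PI)
    by (rewrite S_INR; ring).
  rewrite neg_cos, IH; ring.
Qed.

Lemma sawtooth_err'_half (M : nat) : sawtooth_err' M (1 / 2) = 0.
Proof.
unfold sawtooth_err'; rewrite Rminus_diag, Rminus_0_r.
rewrite (sum_n_ext _ (fun _ => 0)).
- rewrite sum_n_const; ring.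
- intros n; simpl; unfold freq.
  replace (2 * PI * INR (S n) * (1 / 2)) with (IZR (Z.of_nat (S n)) * PI)
    by (rewrite <- INR_IZR_INZ; field).
  rewrite sin_eq_0_1; [unfold Rdiv; ring|now eexists].
Qed.

Lemma increment_abs_le (f df : R -> R) (a b C : R) :
  (forall t, Rmin a b <= t <= Rmax a b -> is_derive f t (df t)) ->
  (forall t, Rmin a b <= t <= Rmax a b -> Rabs (df t) <= C) ->
  Rabs (f b - f a) <= C * Rabs (b - a).
Proof.
intros Hd Hb.
destruct (MVT_gen f a b df) as [c [Hc ->]].
- intros t Ht; apply Hd; lra.
- intros t Ht; apply continuity_pt_filterlim.
  apply (ex_derive_continuous (K := R_AbsRing) (V := R_NormedModule)).
  eexists; now apply Hd.
- rewrite Rabs_mult; apply Rmult_le_compat_r; [apply Rabs_pos|now apply Hb].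
Qed.

Lemma sawtooth_err'_bound (M : nat) (s : R) : 0 < s < 1 ->
  Rabs (sawtooth_err' M s) <= 2 / sin (PI * s) ^ 2 / (2 * INR M + 3).
Proof.
intros Hs; assert (HP := PI_RGT_0); assert (HP3 := PI2_3_2).
unfold PI2 in HP3.
set (kap := (2 * INR M + 3) * PI).
assert (HM := pos_INR M).
assert (Hk : 0 < kap) by (unfold kap; nra).
(* Integration by parts: the subtracted term is the leading antiderivative of the oscillating
   quotient - sin(kap v) / sin(PI v), and what remains has a derivative of size 1 / kap. *)
set (A := fun v => sawtooth_err' M v - cos (kap * v) / (kap * sin (PI * v))).
assert (Hr : forall v, Rmin s (1 / 2) <= v <= Rmax s (1 / 2) -> 0 < v < 1).
{ intros v Hv; assert (H1 := Rmin_glb_lt s (1 / 2) 0); assert (H2 := Rmax_lub_lt s (1 / 2) 1); lra. }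
set (sg := sin (PI * s)).
assert (Hsg : 0 < sg) by (apply sin_gt_0; nra).
assert (Hsg1 : sg <= 1) by apply SIN_bound.
assert (HA : Rabs (A s - A (1 / 2)) <= PI / (kap * sg ^ 2) * Rabs (s - 1 / 2)).
{ apply (increment_abs_le A (fun v => PI * cos (kap * v) * cos (PI * v)
    / (kap * sin (PI * v) ^ 2))).
  - rewrite Rmin_comm, Rmax_comm; intros v Hv.
    destruct (sin_PI_ge s v Hs Hv) as [H1 H2].
    evar_last.
    + apply (is_derive_minus (V := R_NormedModule)).
      * now apply is_derive_sawtooth_err', Hr.
      * auto_derive; [|reflexivity]. apply Rgt_not_eq, Rmult_lt_0_compat; lra.
    + fold kap; unfold minus, plus, opp; simpl; field; lra.
  - rewrite Rmin_comm, Rmax_comm; intros v Hv.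
    destruct (sin_PI_ge s v Hs Hv) as [H1 H2]; fold sg in H1, H2.
    assert (Hq : 0 < kap * sin (PI * v) ^ 2)
      by (apply Rmult_lt_0_compat; [easy|apply pow_lt; lra]).
    unfold Rdiv; rewrite Rabs_mult, (Rabs_pos_eq (/ _))
      by (left; now apply Rinv_0_lt_compat).
    rewrite !Rabs_mult, (Rabs_pos_eq PI) by lra.
    apply Rmult_le_compat; [| |
      |apply Rinv_le_contravar;
        [apply Rmult_lt_0_compat; [easy|apply pow_lt; lra]
        |apply Rmult_le_compat_l; [lra|apply pow_incr; lra]]].
    + apply Rmult_le_pos; [apply Rmult_le_pos; [lra|]|]; apply Rabs_pos.
    + left; now apply Rinv_0_lt_compat.
    + assert (Hc1 : Rabs (cos (kap * v)) <= 1) by (apply Rabs_le, COS_bound).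
      assert (Hc2 : Rabs (cos (PI * v)) <= 1) by (apply Rabs_le, COS_bound).
      assert (Hp1 := Rabs_pos (cos (kap * v))); assert (Hp2 := Rabs_pos (cos (PI * v))).
      assert (Rabs (cos (kap * v)) * Rabs (cos (PI * v)) <= 1) by nra; nra. }
assert (HA0 : A (1 / 2) = 0).
{ unfold A; rewrite sawtooth_err'_half; unfold kap; rewrite cos_half_odd.
  unfold Rdiv; ring. }
rewrite HA0, Rminus_0_r in HA.
replace (sawtooth_err' M s) with (A s + cos (kap * s) / (kap * sg))
  by (unfold A, sg; ring).
eapply Rle_trans; [apply Rabs_triang|].
assert (Hsq : 0 < sg ^ 2 <= sg) by (simpl; nra).
assert (Hq1 : 0 < kap * sg ^ 2) by (apply Rmult_lt_0_compat; lra).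
assert (Hq2 : 0 < kap * sg) by (apply Rmult_lt_0_compat; lra).
assert (H1 : Rabs (cos (kap * s) / (kap * sg)) <= 1 / (kap * sg ^ 2)).
{ unfold Rdiv; rewrite Rabs_mult, (Rabs_pos_eq (/ _))
    by (left; now apply Rinv_0_lt_compat).
  apply Rmult_le_compat; [apply Rabs_pos| |apply Rabs_le, COS_bound|].
  - left; now apply Rinv_0_lt_compat.
  - apply Rinv_le_contravar; [easy|apply Rmult_le_compat_l; lra]. }
assert (H2 : Rabs (s - 1 / 2) <= 1 / 2) by (apply Rabs_le; lra).
assert (H3 : 0 < / (kap * sg ^ 2)) by (now apply Rinv_0_lt_compat).
(* Both contributions are multiples of 1 / (kap sg^2), with factors PI / 2 and 1; together they stay
   below 2 PI, which is the constant 2 of the statement once PI is cancelled from kap. *)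
apply Rle_trans with (PI / (kap * sg ^ 2) * (1 / 2) + 1 / (kap * sg ^ 2)).
{ apply Rplus_le_compat; [|easy].
  eapply Rle_trans; [exact HA|].
  apply Rmult_le_compat_l; [|easy]; unfold Rdiv; nra. }
replace (2 / sg ^ 2 / (2 * INR M + 3)) with (2 * PI / (kap * sg ^ 2)).
- unfold Rdiv; nra.
- unfold kap; field; split; [|split]; lra.
Qed.

(** The increments of [sawtooth_err M] from the midpoint are O(1/M), so its limit is constant on the
    open interval. The constant is read off at 1/2, where - (s^2 - s) / 2 = 1/8. *)
Lemma kernel2_unit (s : R) : 0 < s < 1 ->
  kernel 2 s - (s ^ 2 - s) / 2 = kernel 2 (1 / 2) + 1 / 8.
Proof.
intros Hs; assert (HP := PI_RGT_0).
set (sg := sin (PI * s)).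
assert (Hsg : 0 < sg) by (apply sin_gt_0; nra).
assert (Hb : forall M, Rabs (sawtooth_err M s - sawtooth_err M (1 / 2))
  <= 2 / sg ^ 2 * / INR (S M)).
{ intros M; assert (HM := pos_INR M).
  assert (H : Rabs (sawtooth_err M s - sawtooth_err M (1 / 2))
    <= 2 / sg ^ 2 / (2 * INR M + 3) * Rabs (s - 1 / 2)).
  { apply (increment_abs_le _ (sawtooth_err' M)).
    - intros v _; apply is_derive_sawtooth_err.
    - rewrite Rmin_comm, Rmax_comm; intros v Hv.
      destruct (sin_PI_ge s v Hs Hv) as [H1 H2]; fold sg in H1, H2.
      assert (0 < v < 1).
      { assert (H3 := Rmin_glb_lt s (1 / 2) 0); assert (H4 := Rmax_lub_lt s (1 / 2) 1); lra. }
      eapply Rle_trans; [now apply sawtooth_err'_bound|].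
      unfold Rdiv; apply Rmult_le_compat_r; [left; apply Rinv_0_lt_compat; lra|].
      apply Rmult_le_compat_l; [lra|].
      apply Rinv_le_contravar; nra. }
  eapply Rle_trans; [exact H|].
  assert (Hs2 : Rabs (s - 1 / 2) <= 1) by (apply Rabs_le; lra).
  assert (H0 : 0 < 2 / sg ^ 2) by (apply Rdiv_lt_0_compat; nra).
  assert (H1 : / (2 * INR M + 3) <= / INR (S M)).
  { apply Rinv_le_contravar; rewrite S_INR; lra. }
  assert (H2 : 0 < / (2 * INR M + 3)) by (apply Rinv_0_lt_compat; lra).
  unfold Rdiv at 1; rewrite Rmult_assoc; apply Rmult_le_compat_l; [lra|].
  assert (H3 := Rabs_pos (s - 1 / 2)); nra. }
assert (Hl : forall v, is_lim_seq (fun M => sawtooth_err M v) (kernel 2 v - (v ^ 2 - v) / 2)).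
{ intros v; apply (is_lim_seq_minus' _ _ (kernel 2 v) ((v ^ 2 - v) / 2)).
  - apply is_lim_seq_sum_n, ex_series_kernel; lia.
  - apply is_lim_seq_const. }
assert (Hl2 := is_lim_seq_minus' _ _ _ _ (Hl s) (Hl (1 / 2))).
assert (H0 : is_lim_seq (fun M => sawtooth_err M s - sawtooth_err M (1 / 2)) 0).
{ apply is_lim_seq_abs_0.
  apply (is_lim_seq_le_le (fun _ => 0) _ (fun M => 2 / sg ^ 2 * / INR (S M))).
  - intros M; split; [apply Rabs_pos|apply Hb].
  - apply is_lim_seq_const.
  - replace (Finite 0) with (Finite (2 / sg ^ 2 * 0)) by (f_equal; ring).
    apply (is_lim_seq_scal_l _ (2 / sg ^ 2) 0).
    apply (is_lim_seq_incr_1 (fun n => / INR n) 0).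
    apply (is_lim_seq_inv INR p_infty); [apply is_lim_seq_INR | easy]. }
assert (Heq := eq_trans (eq_sym (is_lim_seq_unique _ _ Hl2)) (is_lim_seq_unique _ _ H0)).
injection Heq; intros; lra.
Qed.

(** Periodicity carries the formula of the first unit interval to the others. The jumps of this
    sawtooth at the integers produce the trapezoidal terms of Euler-Maclaurin. *)
Lemma is_derive_kernel2 (k : nat) (t : R) : INR k < t < INR k + 1 ->
  is_derive (kernel 2) t (t - INR k - 1 / 2).
Proof.
intros Ht.
assert (Hp : forall u, kernel 2 u = kernel 2 (u - INR k)).
{ intros u; rewrite <- (kernel_periodic 2 k (u - INR k)); f_equal; ring. }
apply (is_derive_ext_loc
  (fun t => kernel 2 (1 / 2) + 1 / 8 + ((t - INR k) ^ 2 - (t - INR k)) / 2)).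
- assert (Hpos : 0 < Rmin (t - INR k) (INR k + 1 - t)) by (apply Rmin_glb_lt; lra).
  exists (mkposreal _ Hpos); intros s Hs.
  unfold ball in Hs; simpl in Hs; unfold AbsRing_ball, abs, minus, plus, opp in Hs; simpl in Hs.
  assert (Hs' : Rabs (s - t) < Rmin (t - INR k) (INR k + 1 - t)) by exact Hs.
  apply Rabs_lt_between in Hs'.
  assert (H1 := Rmin_l (t - INR k) (INR k + 1 - t)).
  assert (H2 := Rmin_r (t - INR k) (INR k + 1 - t)).
  rewrite <- (kernel2_unit (s - INR k)) by lra.
  rewrite (Hp s); change (kernel 2 (s - INR k) - ((s - INR k) ^ 2 - (s - INR k)) / 2
    + ((s - INR k) ^ 2 - (s - INR k)) / 2 = kernel 2 (s - INR k)); ring.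
- auto_derive; trivial; field.
Qed.

(** * Euler-Maclaurin summation *)

(** The kernel values are a parameter [k], because the same sum occurs with running values
    [kernel (i + 2) t] inside a unit interval and with the constants [kernel (i + 2) 0] at integers.
    The functions [hd i] stand for the successive derivatives of [hd 0]. *)
Definition em_sum (hd : nat -> R -> R) (y : R) (k : nat -> R) (j : nat) (u : R) : R :=
  sum_n (fun i => (-1) ^ (i + 1) * k i * y ^ (i + 1) * hd (i + 1)%nat u) j.

(** By the product rule each term yields two pieces of opposite sign to those of its neighbours;
    only the first sawtooth piece and the last one survive the telescoping. *)
Lemma is_derive_em_sum (hd : nat -> R -> R) (y : R) (n j : nat) (t : R) :
  (forall (i : nat) (t : R), is_derive (hd i) t (hd (S i) t)) ->
  INR n < t < INR n + 1 ->
  is_derive (fun t => em_sum hd y (fun i => kernel (i + 2) t) j (y * t)) t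
    (- (t - INR n - 1 / 2) * y * hd 1%nat (y * t)
     + (-1) ^ (j + 1) * kernel (j + 2) t * y ^ (j + 2) * hd (j + 2)%nat (y * t)).
Proof.
intros Hd Ht.
assert (Hterm : forall (i : nat) (dk : R), is_derive (kernel (i + 2)) t dk ->
  is_derive (fun t => (-1) ^ (i + 1) * kernel (i + 2) t * y ^ (i + 1) * hd (i + 1)%nat (y * t)) t
    ((-1) ^ (i + 1) * y ^ (i + 1) *
      (dk * hd (i + 1)%nat (y * t) + kernel (i + 2) t * (y * hd (i + 2)%nat (y * t))))).
{ intros i dk Hk.
  apply (is_derive_ext (fun t => (-1) ^ (i + 1) * y ^ (i + 1)
    * (kernel (i + 2) t * hd (i + 1)%nat (y * t)))).
  { intros s; real_eq; ring. }
  apply is_derive_scal.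
  apply (is_derive_mult (K := R_AbsRing) (kernel (i + 2)) (fun t => hd (i + 1)%nat (y * t)));
    [easy| |intros; apply Rmult_comm].
  apply (is_derive_comp (hd (i + 1)%nat) (fun t => y * t)).
  - replace (i + 2)%nat with (S (i + 1)) by lia; apply Hd.
  - auto_derive; trivial; ring. }
induction j as [|j IH].
- unfold em_sum.
  apply (is_derive_ext (fun t => (-1) ^ (0 + 1) * kernel (0 + 2) t * y ^ (0 + 1)
    * hd (0 + 1)%nat (y * t))).
  { intros s; now rewrite sum_O. }
  evar_last; [apply Hterm; simpl; now apply (is_derive_kernel2 n)|].
  simpl; ring.
- unfold em_sum in *.
  eapply is_derive_ext.
  { intros s; symmetry; apply sum_n_S. }
  evar_last.
  + apply (is_derive_plus (V := R_NormedModule)); [exact IH|].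
    apply Hterm; replace (S j + 2)%nat with (S (j + 2)) by lia.
    apply is_derive_kernel; lia.
  + unfold plus; cbn -[pow kernel].
    replace (j + 1)%nat with (S j) by lia; replace (j + 2)%nat with (S (S j)) by lia.
    simpl; ring.
Qed.

Section EulerMaclaurin.

Variables (hd : nat -> R -> R) (H : R -> R) (j : nat) (c : R).
Hypothesis Hd : forall (i : nat) (t : R), is_derive (hd i) t (hd (S i) t).
Hypothesis HH : forall t : R, is_derive H t (hd 0%nat t).
Hypothesis Hc : forall t, 0 <= t -> Rabs (hd (j + 2)%nat t) <= c / (1 + t ^ 2).

(** [V] collects the endpoint terms at integers apart from the trapezoidal ones; [G] is the
    primitive of the remainder bound, which is why the decay hypothesis has the form c / (1 +
    t^2). *)
Let V (y t : R) : R := em_sum hd y (fun i => kernel (i + 2) 0) j (y * t) - H (y * t) / y.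
Let G (y t : R) : R := kernel_sup * c * y ^ (j + 1) * atan (y * t).

Lemma euler_maclaurin_step (y : R) (n : nat) : 0 < y ->
  Rabs ((hd 0%nat (y * INR (S n)) + hd 0%nat (y * INR n)) / 2
        + V y (INR (S n)) - V y (INR n))
  <= G y (INR (S n)) - G y (INR n).
Proof.
intros Hy.
(* At the two ends t - n - 1/2 equals 1/2 and -1/2, which gives the trapezoidal terms; inside,
   everything in the derivative of [psi] cancels except the last piece of [em_sum]. *)
set (psi := fun t => (t - INR n - 1 / 2) * hd 0%nat (y * t)
  + (em_sum hd y (fun i => kernel (i + 2) t) j (y * t) - H (y * t) / y)).
assert (Hcomp : forall (f : R -> R) (df t : R), is_derive f (y * t) df ->
  is_derive (fun t => f (y * t)) t (y * df)).
{ intros f df t Hf; apply (is_derive_comp f (fun t => y * t)); [easy|].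
  auto_derive; trivial; ring. }
assert (Hcont : forall (f : R -> R) (df t : R), is_derive f (y * t) df ->
  continuous (fun t => f (y * t)) t).
{ intros f df t Hf.
  apply (ex_derive_continuous (K := R_AbsRing) (V := R_NormedModule)).
  eexists; now eapply Hcomp; apply Hf. }
assert (Hends : (hd 0%nat (y * INR (S n)) + hd 0%nat (y * INR n)) / 2
        + V y (INR (S n)) - V y (INR n) = psi (INR (S n)) - psi (INR n)).
{ assert (Hk : forall k, em_sum hd y (fun i => kernel (i + 2) (INR k)) j (y * INR k)
    = em_sum hd y (fun i => kernel (i + 2) 0) j (y * INR k)).
  { intros k; apply sum_n_ext; intros i; now rewrite kernel_INR. }
  unfold psi, V; rewrite !Hk, S_INR; field; lra. }
rewrite Hends.
assert (Hlt : INR n < INR (S n)) by (rewrite S_INR; lra).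
(* Differentiability is available only in the open interval, because [kernel 2] has corners at the
   integers; continuity suffices at the ends. *)
apply (increment_le psi
  (fun t => (-1) ^ (j + 1) * kernel (j + 2) t * y ^ (j + 2) * hd (j + 2)%nat (y * t))
  (G y) (fun t => kernel_sup * c * y ^ (j + 2) / (1 + (y * t) ^ 2))).
- lra.
- intros t Ht; rewrite S_INR in Ht.
  evar_last.
  + apply (is_derive_plus (V := R_NormedModule)).
    * apply (is_derive_mult (K := R_AbsRing) (fun t => t - INR n - 1 / 2)
        (fun t => hd 0%nat (y * t)) t 1); [| |intros; apply Rmult_comm].
      -- auto_derive; trivial; ring.
      -- apply Hcomp, Hd.
    * apply (is_derive_minus (V := R_NormedModule)).
      -- now apply is_derive_em_sum with (n := n).
      -- apply (is_derive_ext (fun t => / y * H (y * t))).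
         { intros s; apply Rmult_comm. }
         apply is_derive_scal, Hcomp, HH.
  + unfold plus, minus, mult, opp; cbn -[pow kernel]; unfold plus; cbn -[pow kernel].
    field; lra.
- intros t Ht; unfold G; auto_derive; trivial.
  replace (j + 2)%nat with (S (j + 1)) by lia; simpl.
  field; nra.
- intros t Ht.
  apply (continuous_plus (V := R_NormedModule)).
  + apply (continuous_mult (K := R_AbsRing)).
    * apply (ex_derive_continuous (K := R_AbsRing) (V := R_NormedModule)).
      auto_derive; trivial.
    * eapply Hcont, Hd.
  + apply (continuous_minus (V := R_NormedModule)).
    * apply (continuous_sum_n (fun i t => (-1) ^ (i + 1) * kernel (i + 2) t
        * y ^ (i + 1) * hd (i + 1)%nat (y * t))).
      intros i.
      apply (continuous_mult (K := R_AbsRing)); [|eapply Hcont, Hd].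
      apply (continuous_mult (K := R_AbsRing)); [|apply continuous_const].
      apply (continuous_scal_r (V := R_NormedModule)), continuous_kernel; lia.
    * apply (continuous_mult (K := R_AbsRing)); [|apply continuous_const].
      eapply Hcont, HH.
- intros t Ht.
  apply (ex_derive_continuous (K := R_AbsRing) (V := R_NormedModule)).
  unfold G; auto_derive; trivial.
- intros t Ht.
  assert (Ht0 : 0 <= t) by (assert (Hn := pos_INR n); lra).
  rewrite !Rabs_mult, pow_1_abs, Rmult_1_l.
  rewrite (Rabs_pos_eq (y ^ _)) by (apply pow_le; lra).
  unfold Rdiv; rewrite !Rmult_assoc.
  apply Rmult_le_compat; [apply Rabs_pos | | apply kernel_bound; lia | ].
  { apply Rmult_le_pos; [apply pow_le; lra|apply Rabs_pos]. }
  rewrite <- (Rmult_assoc c), (Rmult_comm c), Rmult_assoc.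
  apply Rmult_le_compat_l; [apply pow_le; lra|].
  apply Hc; nra.
Qed.

Lemma euler_maclaurin_finite (y : R) (K : nat) : 0 < y ->
  Rabs (sum_n (fun n => hd 0%nat (y * INR (S n))) K
        + (hd 0%nat 0 - hd 0%nat (y * INR (S K))) / 2
        + V y (INR (S K)) - V y 0)
  <= G y (INR (S K)).
Proof.
intros Hy.
assert (HG : G y 0 = 0) by (unfold G; rewrite Rmult_0_r, atan_0; ring).
induction K as [|K IH].
- assert (Hs := euler_maclaurin_step y 0 Hy).
  rewrite sum_O; change (INR 0) with 0 in Hs; rewrite HG, Rminus_0_r in Hs.
  rewrite Rmult_0_r in Hs.
  eapply Rle_trans; [|exact Hs]; right; f_equal; field.
- assert (Hs := euler_maclaurin_step y (S K) Hy).
  rewrite sum_n_S.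
  apply Rabs_le_between in IH; apply Rabs_le_between in Hs; apply Rabs_le; lra.
Qed.

Lemma is_lim_seq_dilate (f : R -> R) (l y : R) : 0 < y ->
  is_lim f p_infty l -> is_lim_seq (fun K => f (y * INR (S K))) l.
Proof.
intros Hy Hf.
apply (is_lim_comp_seq f (fun K => y * INR (S K)) p_infty l Hf).
- now exists 0%nat.
- apply (is_lim_seq_incr_1 (fun K => y * INR K)).
  replace p_infty with (Rbar_mult y p_infty).
  + apply is_lim_seq_scal_l, is_lim_seq_INR.
  + simpl; destruct (Rle_dec 0 y) as [Hle|]; [|lra].
    destruct (Rle_lt_or_eq_dec 0 y Hle); [easy|lra].
Qed.

(** Limit K to infinity of the finite formula: all derivative terms at the upper end die, and the
    primitive contributes [Hinf / y]. *)
Lemma euler_maclaurin (y Hinf S : R) : 0 < y -> 0 <= c ->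
  (forall i, is_lim (hd i) p_infty 0) ->
  is_lim H p_infty Hinf ->
  is_series (fun n => hd 0%nat (y * INR (Datatypes.S n))) S ->
  Rabs (S - ((Hinf - H 0) / y - hd 0%nat 0 / 2
             + em_sum hd y (fun i => kernel (i + 2) 0) j 0))
  <= kernel_sup * c * 2 * y ^ (j + 1).
Proof.
intros Hy Hc0 Hlim HlimH HS.
set (E := fun K => sum_n (fun n => hd 0%nat (y * INR (Datatypes.S n))) K
        + (hd 0%nat 0 - hd 0%nat (y * INR (Datatypes.S K))) / 2
        + V y (INR (Datatypes.S K)) - V y 0).
assert (HV : is_lim_seq (fun K => V y (INR (Datatypes.S K))) (0 - Hinf / y)).
{ apply (is_lim_seq_minus' _ _ 0 (Hinf / y)).
  - unfold em_sum; clear - Hlim Hy; induction j as [|k IH].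
    + apply (is_lim_seq_ext (fun K => (-1) ^ (0 + 1) * kernel (0 + 2) 0 * y ^ (0 + 1)
        * hd (0 + 1)%nat (y * INR (Datatypes.S K)))).
      { intros n; now rewrite sum_O. }
      evar_last; [apply (is_lim_seq_scal_l _ _ 0), is_lim_seq_dilate, Hlim; easy|].
      simpl; f_equal; ring.
    + eapply is_lim_seq_ext.
      { intros n; symmetry; apply sum_n_S. }
      replace (Finite 0) with (Finite (0 + 0)) by (f_equal; ring).
      apply is_lim_seq_plus'; [exact IH|].
      evar_last; [apply (is_lim_seq_scal_l _ _ 0), is_lim_seq_dilate, Hlim; easy|].
      simpl; f_equal; ring.
  - apply (is_lim_seq_scal_r _ (/ y) Hinf).
    now apply is_lim_seq_dilate. }
assert (HE : is_lim_seq E (S + (hd 0%nat 0 - 0) / 2 + (0 - Hinf / y) - V y 0)).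
{ apply is_lim_seq_minus'; [|apply is_lim_seq_const].
  apply is_lim_seq_plus'; [|exact HV].
  apply is_lim_seq_plus'; [exact HS|].
  apply (is_lim_seq_scal_r _ (/ 2) (hd 0%nat 0 - 0)).
  apply is_lim_seq_minus'; [apply is_lim_seq_const|].
  now apply is_lim_seq_dilate. }
replace (S - ((Hinf - H 0) / y - hd 0%nat 0 / 2
             + em_sum hd y (fun i => kernel (i + 2) 0) j 0))
  with (S + (hd 0%nat 0 - 0) / 2 + (0 - Hinf / y) - V y 0).
2:{ unfold V; rewrite Rmult_0_r; field; lra. }
(* PI <= 4 turns the bound PI / 2 on the arctangent into the factor 2. *)
assert (HP := PI_4).
assert (Hks : 0 <= kernel_sup).
{ eapply Rle_trans; [apply Rabs_pos|apply (kernel_bound 2 0); lia]. }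
apply is_lim_seq_abs in HE.
refine (is_lim_seq_le _ _ _ _ _ HE (is_lim_seq_const (kernel_sup * c * 2 * y ^ (j + 1)))).
intros K; eapply Rle_trans; [now apply euler_maclaurin_finite|]; unfold G.
replace (kernel_sup * c * 2 * y ^ (j + 1)) with (kernel_sup * c * y ^ (j + 1) * 2) by ring.
apply Rmult_le_compat_l.
{ apply Rmult_le_pos; [now apply Rmult_le_pos|apply pow_le; lra]. }
assert (Ha := atan_bound (y * INR (Datatypes.S K))); lra.
Qed.

End EulerMaclaurin.

(** * Asymptotic power series at 0+ *)

(** The fixed interval 0 < y <= 1 spares intersecting neighbourhoods when expansions are
    combined. *)
Definition expands_upto (f : R -> R) (a : nat -> R) (M : nat) : Prop :=
  exists C, forall y, 0 < y <= 1 ->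
    Rabs (f y - sum_n (fun m => a m * y ^ m) M) <= C * y ^ S M.

Definition expands (f : R -> R) (a : nat -> R) : Prop := forall M, expands_upto f a M.

Lemma pow_le_pow (y : R) (m n : nat) : 0 < y <= 1 -> (m <= n)%nat -> y ^ n <= y ^ m.
Proof.
intros Hy Hmn; replace n with (m + (n - m))%nat by lia.
rewrite pow_add; rewrite <- (Rmult_1_r (y ^ m)) at 2.
apply Rmult_le_compat_l; [apply pow_le; lra|].
rewrite <- (pow1 (n - m)); apply pow_incr; lra.
Qed.

(** Euler-Maclaurin leaves an error of the same order as the last retained term; that term is moved
    into the error. *)
Lemma expands_upto_weak (f : R -> R) (a : nat -> R) (M : nat) (C : R) :
  (forall y, 0 < y <= 1 ->
     Rabs (f y - sum_n (fun m => a m * y ^ m) (S M)) <= C * y ^ S M) ->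
  expands_upto f a M.
Proof.
intros HC; exists (C + Rabs (a (S M))); intros y Hy.
specialize (HC y Hy); rewrite sum_n_S in HC.
assert (Hp : 0 <= y ^ S M) by (apply pow_le; lra).
replace (f y - sum_n (fun m => a m * y ^ m) M)
  with ((f y - (sum_n (fun m => a m * y ^ m) M + a (S M) * y ^ S M)) + a (S M) * y ^ S M)
  by ring.
eapply Rle_trans; [apply Rabs_triang|].
rewrite (Rabs_mult (a (S M))), (Rabs_pos_eq (y ^ S M)) by easy; lra.
Qed.

Lemma expands_upto_pred (f : R -> R) (a : nat -> R) (M : nat) :
  expands_upto f a (S M) -> expands_upto f a M.
Proof.
intros [C HC]; apply (expands_upto_weak f a M (Rabs C)); intros y Hy.
eapply Rle_trans; [now apply HC|].
assert (Hq : 0 <= y ^ S (S M) <= y ^ S M).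
{ split; [apply pow_le; lra|now apply pow_le_pow; [|lia]]. }
assert (HC' : C <= Rabs C) by apply Rle_abs.
assert (0 <= Rabs C) by apply Rabs_pos; nra.
Qed.

Lemma expands_upto_le (f : R -> R) (a : nat -> R) (M M' : nat) :
  (M <= M')%nat -> expands_upto f a M' -> expands_upto f a M.
Proof.
intros Hle; induction Hle as [|M' Hle IH]; [easy|].
intros H; now apply IH, expands_upto_pred.
Qed.

Lemma expands_upto_unique (f : R -> R) (a b : nat -> R) (m : nat) :
  expands_upto f a m -> expands_upto f b m -> (forall i, (i < m)%nat -> a i = b i) ->
  a m = b m.
Proof.
intros [Ca HCa] [Cb HCb] IH.
assert (Hkey : forall y, 0 < y <= 1 -> Rabs (a m - b m) <= (Ca + Cb) * y).
{ intros y Hy; specialize (HCa y Hy); specialize (HCb y Hy).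
  assert (Heq : sum_n (fun m => a m * y ^ m) m - sum_n (fun m => b m * y ^ m) m
    = (a m - b m) * y ^ m).
  { destruct m as [|m]; [rewrite !sum_O; ring|].
    rewrite !sum_n_S.
    rewrite (sum_n_ext_loc (fun m => a m * y ^ m) (fun m => b m * y ^ m)).
    - ring.
    - intros n Hn; rewrite IH by lia; reflexivity. }
  assert (Hp : 0 < y ^ m) by (apply pow_lt; lra).
  apply (Rmult_le_reg_r (y ^ m)); [easy|].
  rewrite <- (Rabs_pos_eq (y ^ m)) at 1 by lra.
  rewrite <- Rabs_mult, <- Heq.
  replace ((Ca + Cb) * y * y ^ m) with (Ca * y ^ S m + Cb * y ^ S m) by (simpl; ring).
  apply Rabs_le_between in HCa; apply Rabs_le_between in HCb; apply Rabs_le; lra. }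
apply Rminus_diag_uniq.
destruct (Req_dec (a m - b m) 0) as [|Hne]; [easy|exfalso].
assert (Hpos := Rabs_pos_lt _ Hne).
set (d := Rabs (a m - b m)) in *.
assert (H1 := Hkey 1 ltac:(lra)).
(* At this point the bound [Hkey] equals d / 2, contradicting d > 0; [H1], the case y = 1, ensures
   that the point is at most 1. *)
assert (Hy : 0 < d / (2 * (Ca + Cb)) <= 1).
{ split; [apply Rdiv_lt_0_compat; lra|].
  apply (Rmult_le_reg_r (2 * (Ca + Cb))); [lra|].
  unfold Rdiv; rewrite Rmult_assoc, Rinv_l; lra. }
specialize (Hkey _ Hy).
replace ((Ca + Cb) * (d / (2 * (Ca + Cb)))) with (d / 2) in Hkey by (field; lra).
lra.
Qed.

Lemma expands_unique (f : R -> R) (a b : nat -> R) :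
  expands f a -> expands f b -> forall m, a m = b m.
Proof.
intros Ha Hb m; induction m as [m IH] using lt_wf_ind.
now apply (expands_upto_unique f).
Qed.

Lemma sum_n_shift (a : nat -> R) (n : nat) :
  sum_n a (S n) = a 0%nat + sum_n (fun k => a (S k)) n :> R.
Proof.
induction n as [|n IH].
- rewrite sum_n_S, !sum_O; ring.
- rewrite sum_n_S, IH, (sum_n_S _ n); ring.
Qed.

Lemma sum_n_Rmult_l (c : R) (a : nat -> R) (n : nat) :
  sum_n (fun k => c * a k) n = c * sum_n a n.
Proof. exact (sum_n_mult_l (K := R_Ring) c a n). Qed.

Lemma sum_n_Rplus (a b : nat -> R) (n : nat) :
  sum_n (fun k => a k + b k) n = sum_n a n + sum_n b n.
Proof. exact (sum_n_plus (G := R_AbelianMonoid) a b n). Qed.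

Lemma expands_tail (f : R -> R) (a : nat -> R) :
  expands f a -> expands (fun y => (f y - a 0%nat) / y) (fun m => a (S m)).
Proof.
intros H M; destruct (H (S M)) as [C HC]; exists C; intros y Hy.
specialize (HC y Hy); rewrite sum_n_shift in HC.
apply (Rmult_le_reg_r y); [lra|].
match goal with |- Rabs ?e * y <= _ => replace (Rabs e * y) with (Rabs (e * y))
  by (rewrite Rabs_mult, (Rabs_pos_eq y) by lra; reflexivity) end.
replace (C * y ^ S M * y) with (C * y ^ S (S M)) by (simpl; ring).
eapply Rle_trans; [|exact HC]; right; f_equal.
rewrite (sum_n_ext (fun k => a (S k) * y ^ S k) (fun k => y * (a (S k) * y ^ k)))
  by (intros n; simpl; ring).
rewrite sum_n_Rmult_l; simpl (y ^ 0); field; lra.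
Qed.

Lemma expands_bounded (f : R -> R) (a : nat -> R) :
  expands f a -> exists C, forall y, 0 < y <= 1 -> Rabs (f y) <= C.
Proof.
intros H; destruct (H 0%nat) as [C HC]; exists (Rabs C + Rabs (a 0%nat)); intros y Hy.
specialize (HC y Hy); rewrite sum_O in HC; simpl in HC; rewrite !Rmult_1_r in HC.
replace (f y) with ((f y - a 0%nat) + a 0%nat) by ring.
eapply Rle_trans; [apply Rabs_triang|]; apply Rplus_le_compat_r.
assert (C <= Rabs C) by apply Rle_abs; assert (0 <= Rabs C) by apply Rabs_pos; nra.
Qed.

Definition cauchy_coef (a b : nat -> R) (n : nat) : R :=
  sum_n (fun k => a k * b (n - k)%nat) n.

(** Induction on the order by peeling one coefficient: f g = a_0 g + y ((f - a_0) / y) g, and the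
    inner quotient again has an expansion by [expands_tail]. *)
Lemma expands_mult (f g : R -> R) (a b : nat -> R) :
  expands f a -> expands g b -> expands (fun y => f y * g y) (cauchy_coef a b).
Proof.
intros Hf Hg M; revert f a Hf; induction M as [|M IH]; intros f a Hf.
- destruct (Hf 0%nat) as [Ca HCa]; destruct (Hg 0%nat) as [Cb HCb].
  destruct (expands_bounded g b Hg) as [Bg HBg].
  exists (Ca * Bg + Rabs (a 0%nat) * Cb); intros y Hy.
  specialize (HCa y Hy); specialize (HCb y Hy); specialize (HBg y Hy).
  unfold cauchy_coef; rewrite sum_O in *; rewrite sum_O; simpl in *.
  rewrite !Rmult_1_r in *.
  replace (f y * g y - a 0%nat * b 0%nat)
    with ((f y - a 0%nat) * g y + a 0%nat * (g y - b 0%nat)) by ring.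
  eapply Rle_trans; [apply Rabs_triang|]; rewrite !Rabs_mult.
  replace ((Ca * Bg + Rabs (a 0%nat) * Cb) * y)
    with (Ca * y * Bg + Rabs (a 0%nat) * (Cb * y)) by ring.
  apply Rplus_le_compat.
  + apply Rmult_le_compat; try apply Rabs_pos; easy.
  + apply Rmult_le_compat_l; [apply Rabs_pos|easy].
- destruct (IH _ _ (expands_tail f a Hf)) as [C1 HC1].
  destruct (Hg (S M)) as [C2 HC2].
  exists (C1 + Rabs (a 0%nat) * C2); intros y Hy.
  specialize (HC1 y Hy); specialize (HC2 y Hy).
  assert (Hcoef : forall n, cauchy_coef a b (S n)
    = a 0%nat * b (S n) + cauchy_coef (fun m => a (S m)) b n).
  { intros n; unfold cauchy_coef; rewrite sum_n_shift; simpl; easy. }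
  replace (f y * g y - sum_n (fun m => cauchy_coef a b m * y ^ m) (S M))
    with (y * ((f y - a 0%nat) / y * g y
               - sum_n (fun m => cauchy_coef (fun m => a (S m)) b m * y ^ m) M)
          + a 0%nat * (g y - sum_n (fun m => b m * y ^ m) (S M))).
  + eapply Rle_trans; [apply Rabs_triang|]; rewrite !Rabs_mult.
    rewrite (Rabs_pos_eq y) by lra.
    assert (Ha := Rabs_pos (a 0%nat)).
    replace ((C1 + Rabs (a 0%nat) * C2) * y ^ S (S M))
      with (y * (C1 * y ^ S M) + Rabs (a 0%nat) * (C2 * y ^ S (S M))) by (simpl; ring).
    apply Rplus_le_compat; apply Rmult_le_compat_l; lra.
  + rewrite !sum_n_shift.
    rewrite (sum_n_ext (fun k => cauchy_coef a b (S k) * y ^ S k)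
      (fun k => a 0%nat * (b (S k) * y ^ S k)
        + y * (cauchy_coef (fun m => a (S m)) b k * y ^ k)))
      by (intros n; rewrite Hcoef; simpl; ring).
    rewrite sum_n_Rplus, !sum_n_Rmult_l.
    unfold cauchy_coef at 2; rewrite sum_O; simpl; field; lra.
Qed.

Lemma is_derive_polynomial (c : nat -> R) (M : nat) (y : R) :
  is_derive (fun y => sum_n (fun m => c m * y ^ m) (S M)) y
    (sum_n (fun m => INR (S m) * c (S m) * y ^ m) M).
Proof.
apply (is_derive_ext (fun y => c 0%nat + sum_n (fun m => c (S m) * y ^ S m) M)).
{ intros t; rewrite (sum_n_shift (fun m => c m * t ^ m)); simpl (t ^ 0).
  now rewrite Rmult_1_r. }
rewrite <- (Rplus_0_l (sum_n _ _)).
apply (is_derive_plus (V := R_NormedModule)); [apply (is_derive_const (V := R_NormedModule))|].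
apply (is_derive_sum_n (fun m y => c (S m) * y ^ S m)); intros k _.
auto_derive; trivial; simpl; ring.
Qed.

(** Taylor's formula by induction: the estimate for the derivative, one order lower, is integrated
    from 0. *)
Lemma expands_taylor (hd : nat -> R -> R) :
  (forall (i : nat) (t : R), is_derive (hd i) t (hd (S i) t)) ->
  expands (hd 0%nat) (fun m => hd m 0 / INR (fact m)).
Proof.
intros Hd M; revert hd Hd; induction M as [|M IH]; intros hd Hd.
- destruct (continuity_ab_maj (fun t => Rabs (hd 1%nat t)) 0 1) as [m [Hm _]]; [lra| |].
  { intros t _; apply continuity_pt_filterlim.
    apply (continuous_comp (hd 1%nat) Rabs); [|apply continuous_Rabs].
    apply (ex_derive_continuous (K := R_AbsRing) (V := R_NormedModule)).
    eexists; apply Hd. }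
  exists (Rabs (hd 1%nat m)); intros y Hy.
  rewrite sum_O; simpl.
  replace (hd 0%nat y - hd 0%nat 0 / 1 * 1) with (hd 0%nat y - hd 0%nat 0) by field.
  rewrite <- (Rabs_pos_eq y) at 2 by lra.
  replace (Rabs y * 1) with (Rabs (y - 0)) by (rewrite Rminus_0_r; ring).
  apply (increment_abs_le (hd 0%nat) (hd 1%nat)); [intros t _; apply Hd|].
  rewrite Rmin_left, Rmax_right by lra; intros t Ht; apply Hm; lra.
- destruct (IH (fun i => hd (S i)) (fun i => Hd (S i))) as [C HC].
  exists (C / INR (S (S M))); intros y Hy.
  set (f := fun t => hd 0%nat t - sum_n (fun m => hd m 0 / INR (fact m) * t ^ m) (S M)).
  set (g := fun t => C / INR (S (S M)) * t ^ S (S M)).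
  assert (Hf : forall t, is_derive f t
    (hd 1%nat t - sum_n (fun m => hd (S m) 0 / INR (fact m) * t ^ m) M)).
  { intros t; apply (is_derive_minus (V := R_NormedModule)); [apply Hd|].
    evar_last; [apply (is_derive_polynomial (fun m => hd m 0 / INR (fact m)))|].
    apply sum_n_ext; intros n; rewrite fact_simpl, mult_INR.
    real_eq; field.
    split; [apply INR_fact_neq_0|apply not_0_INR; lia]. }
  assert (Hg : forall t, is_derive g t (C * t ^ S M)).
  { intros t; evar_last.
    - apply is_derive_scal.
      apply (is_derive_pow (fun t => t) (S (S M)) t 1), (is_derive_id (K := R_AbsRing)).
    - cbn [pred]; field; apply not_0_INR; lia. }
  replace (Rabs (hd 0%nat y - _)) with (Rabs (f y - f 0)).
  + replace (C / INR (S (S M)) * y ^ S (S M)) with (g y - g 0).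
    * apply increment_le with
        (df := fun t => hd 1%nat t - sum_n (fun m => hd (S m) 0 / INR (fact m) * t ^ m) M)
        (dg := fun t => C * t ^ S M); [lra|now intros..| | |].
      -- intros t _; apply (ex_derive_continuous (K := R_AbsRing) (V := R_NormedModule)).
         eexists; apply Hf.
      -- intros t _; apply (ex_derive_continuous (K := R_AbsRing) (V := R_NormedModule)).
         eexists; apply Hg.
      -- intros t Ht; apply HC; lra.
    * unfold g; rewrite (pow_i (S (S M))) by lia; ring.
  + f_equal; unfold f at 2; rewrite sum_n_shift.
    rewrite (sum_n_ext _ (fun _ => 0)) by (intros n; rewrite pow_i by lia; apply Rmult_0_r).
    rewrite sum_n_const; simpl; unfold f; simpl; field.
Qed.

(** * Bernoulli numbers *)

(** One term of the exponential series. Keeping the -1 on the right lets it bound 1 / (exp u - 1)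
    directly. *)
Lemma exp_ge_pow (k : nat) (u : R) : 0 <= u -> u ^ S k / INR (fact (S k)) <= exp u - 1.
Proof.
revert u; induction k as [|k IH]; intros u Hu.
- simpl; assert (H := exp_ineq1_le u); lra.
- set (f := fun t => t ^ S (S k) / INR (fact (S (S k)))).
  assert (Hf : forall t, is_derive f t (t ^ S k / INR (fact (S k)))).
  { intros t; unfold f.
    apply (is_derive_ext (fun t => / INR (fact (S (S k))) * t ^ S (S k))).
    { intros s; apply Rmult_comm. }
    evar_last.
    - apply is_derive_scal.
      apply (is_derive_pow (fun t => t) (S (S k)) t 1), (is_derive_id (K := R_AbsRing)).
    - cbn [pred]; rewrite (fact_simpl (S k)), mult_INR; field.
      split; [apply INR_fact_neq_0|apply not_0_INR; lia]. }
  assert (H : Rabs (f u - f 0) <= exp u - exp 0).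
  { apply (increment_le f (fun t => t ^ S k / INR (fact (S k))) exp exp).
    - easy.
    - intros t _; apply Hf.
    - intros t _; apply is_derive_exp.
    - intros t _; apply (ex_derive_continuous (K := R_AbsRing) (V := R_NormedModule)).
      eexists; apply Hf.
    - intros t _; apply continuous_exp.
    - intros t Ht; rewrite Rabs_pos_eq; [assert (H := IH t ltac:(lra)); lra|].
      apply Rdiv_le_0_compat; [apply pow_le; lra|apply INR_fact_lt_0]. }
  assert (Hf0 : f 0 = 0) by (unfold f; rewrite pow_i by lia; unfold Rdiv; ring).
  rewrite Hf0, exp_0, Rminus_0_r in H.
  eapply Rle_trans; [|exact H]; apply Rle_abs.
Qed.

Lemma exp_INR_mult (n : nat) (x : R) : exp (INR n * x) = exp x ^ n.
Proof.
induction n as [|n IH]; [simpl; rewrite Rmult_0_l; apply exp_0|].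
rewrite S_INR, Rmult_plus_distr_r, exp_plus, IH, Rmult_1_l; simpl; ring.
Qed.

Lemma exp_minus_1_pos (u : R) : 0 < u -> 0 < exp u - 1.
Proof. intros Hu; assert (H := exp_ineq1 u ltac:(lra)); lra. Qed.

Lemma is_lim_inv_sqr_bound (f : R -> R) (C : R) :
  (forall t, 0 <= t -> Rabs (f t) <= C / (1 + t ^ 2)) -> is_lim f p_infty 0.
Proof.
intros Hf.
apply is_lim_spec; intros eps.
assert (HC : 0 <= C).
{ assert (H := Hf 0 ltac:(lra)); assert (H' := Rabs_pos (f 0)).
  replace (1 + 0 ^ 2) with 1 in H by ring; lra. }
exists (C / eps); intros t Ht.
assert (He := cond_pos eps).
assert (Ht0 : 0 <= t).
{ left; eapply Rle_lt_trans; [|exact Ht]; apply Rdiv_le_0_compat; lra. }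
rewrite Rminus_0_r; eapply Rle_lt_trans; [now apply Hf|].
assert (Hct : C < eps * t).
{ apply (Rmult_lt_compat_l eps) in Ht; [|easy].
  replace (eps * (C / eps)) with C in Ht by (field; lra); lra. }
apply (Rmult_lt_reg_r (1 + t ^ 2)); [nra|].
unfold Rdiv; rewrite Rmult_assoc, Rinv_l by nra.
assert (t < 1 + t ^ 2) by (simpl; nra); nra.
Qed.

(* Bernoulli numbers over factorials, in terms of the kernels. *)
Definition bcoef (m : nat) : R :=
  match m with
  | O => 1
  | S O => - (1 / 2)
  | _ => kernel m 0
  end.

(* Euler-Maclaurin for [exp (- t)], whose sum is a geometric series. *)
Lemma bernoulli_function_expands : expands (fun y => y / (exp y - 1)) bcoef.
Proof.
set (hd := fun (i : nat) t => (-1) ^ i * exp (- t)).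
assert (Hd : forall (i : nat) (t : R), is_derive (hd i) t (hd (S i) t)).
{ intros i t; unfold hd; auto_derive; trivial; simpl; ring. }
assert (HH : forall t : R, is_derive (fun t => - exp (- t)) t (hd 0%nat t)).
{ intros t; unfold hd; auto_derive; trivial; simpl; ring. }
assert (Hb : forall i t, 0 <= t -> Rabs (hd i t) <= 2 / (1 + t ^ 2)).
{ intros i t Ht; unfold hd; rewrite Rabs_mult, pow_1_abs, Rmult_1_l.
  rewrite Rabs_pos_eq by (left; apply exp_pos); rewrite exp_Ropp.
  replace (2 / (1 + t ^ 2)) with (/ ((1 + t ^ 2) / 2)) by (field; nra).
  apply Rinv_le_contravar; [nra|].
  assert (H := exp_ge_pow 1 t Ht); simpl in H; simpl; lra. }
(* At depth M, after multiplication by y, Euler-Maclaurin has both its last term and its error of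
   order y^(M+2); this gives an expansion up to M + 1. *)
intros M; apply (expands_upto_le _ _ M (S M)); [lia|].
apply (expands_upto_weak _ _ (S M) (kernel_sup * 2 * 2)); intros y Hy.
assert (Hy1 := exp_minus_1_pos y ltac:(lra)).
assert (HS : is_series (fun n => hd 0%nat (y * INR (S n))) (/ (exp y - 1))).
{ assert (Hq : Rabs (exp (- y)) < 1).
  { rewrite Rabs_pos_eq by (left; apply exp_pos); rewrite <- exp_0.
    apply exp_increasing; lra. }
  assert (H := is_series_geom _ Hq).
  apply (is_series_scal_l (exp (- y))) in H.
  replace (/ (exp y - 1)) with (scal (exp (- y)) (/ (1 - exp (- y)))).
  - eapply is_series_ext; [|exact H]; intros n.
    unfold hd, scal; simpl pow; cbn -[INR exp pow]; unfold mult; cbn -[INR exp pow].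
    rewrite Rmult_1_l, <- exp_INR_mult, <- exp_plus, S_INR; f_equal; ring.
  - unfold scal; cbn -[exp]; unfold mult; cbn -[exp].
    rewrite exp_Ropp; field; repeat split; lra. }
assert (Hem := euler_maclaurin hd (fun t => - exp (- t)) M 2 Hd HH
  (Hb (M + 2)%nat) y 0 (/ (exp y - 1)) ltac:(lra) ltac:(lra)
  (fun i => is_lim_inv_sqr_bound _ _ (Hb i))).
assert (Hlim : is_lim (fun t => - exp (- t)) p_infty 0).
{ apply (is_lim_ext (hd 1%nat)); [intros t; unfold hd; simpl; ring|].
  apply (is_lim_inv_sqr_bound _ _ (Hb 1%nat)). }
specialize (Hem Hlim HS).
rewrite sum_n_shift, sum_n_shift.
assert (Hs : em_sum hd y (fun i => kernel (i + 2) 0) M 0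
  = sum_n (fun k => kernel (S (S k)) 0 * y ^ S k) M).
{ apply sum_n_ext; intros i; unfold hd.
  rewrite Ropp_0, exp_0, Rmult_1_r.
  replace (i + 2)%nat with (S (S i)) by lia; replace (i + 1)%nat with (S i) by lia.
  (* The sign in [em_sum] cancels that of the derivative of exp (- t) at 0. *)
  transitivity ((-1 * -1) ^ S i * kernel (S (S i)) 0 * y ^ S i).
  - rewrite Rpow_mult_distr; real_eq; ring.
  - replace (-1 * -1) with 1 by ring; rewrite pow1.
    real_eq; ring. }
rewrite Hs in Hem.
assert (Hsum : sum_n (fun k => bcoef (S (S k)) * y ^ S (S k)) M
  = y * sum_n (fun k => kernel (S (S k)) 0 * y ^ S k) M).
{ rewrite <- sum_n_Rmult_l; apply sum_n_ext; intros k; simpl.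
  real_eq; ring. }
rewrite Hsum.
set (T := sum_n (fun k => kernel (S (S k)) 0 * y ^ S k) M) in *.
unfold hd in Hem; rewrite Ropp_0, exp_0 in Hem; simpl (_ ^ 0) in Hem.
replace (y / (exp y - 1) - _) with
  (y * (/ (exp y - 1) - ((0 - - (1)) / y - 1 * 1 / 2 + T)))
  by (simpl; field; lra).
rewrite Rabs_mult, (Rabs_pos_eq y) by lra.
replace (kernel_sup * 2 * 2 * y ^ S (S M)) with (y * (kernel_sup * 2 * 2 * y ^ (M + 1)))
  by (replace (M + 1)%nat with (S M) by lia; simpl; ring).
apply Rmult_le_compat_l; [lra|exact Hem].
Qed.

Lemma expands_exp : expands exp (fun m => / INR (fact m)).
Proof.
assert (H := expands_taylor (fun _ => exp) (fun _ t => is_derive_exp t)).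
intros M; destruct (H M) as [C HC]; exists C; intros y Hy.
rewrite (sum_n_ext _ (fun m => exp 0 / INR (fact m) * y ^ m)); [now apply HC|].
intros n; rewrite exp_0; unfold Rdiv; now rewrite Rmult_1_l.
Qed.

(** Coefficients are compared in y / (exp y - 1) * (exp y - 1) / y = 1, using uniqueness of
    expansions. *)
Lemma bcoef_rec (n : nat) : (1 <= n)%nat ->
  sum_n (fun k => bcoef k * / INR (fact (S (n - k)))) n = 0.
Proof.
intros Hn.
assert (H1 := expands_mult _ _ _ _ bernoulli_function_expands (expands_tail _ _ expands_exp)).
assert (H2 : expands (fun y => y / (exp y - 1) * ((exp y - / INR (fact 0)) / y))
  (fun m => match m with O => 1 | _ => 0 end)).
{ intros M; exists 0; intros y Hy.
  assert (Hy1 := exp_minus_1_pos y ltac:(lra)).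
  replace (sum_n _ M) with 1.
  - right; rewrite Rmult_0_l; replace (_ - 1) with 0 by (simpl; field; lra).
    apply Rabs_R0.
  - destruct M as [|M]; [rewrite sum_O; simpl; ring|].
    rewrite sum_n_shift, (sum_n_ext _ (fun _ => 0)) by (intros k; apply Rmult_0_l).
    rewrite sum_n_const; simpl; ring. }
assert (H := expands_unique _ _ _ H1 H2 n).
destruct n as [|n]; [lia|exact H].
Qed.

(** [bcoef_rec] multiplied by (n + 1)! is the binomial recurrence [bernoulli_rec]. At even indices
    this is Euler's formula for zeta(2k). *)
Lemma bernoulli_bcoef (n : nat) : bernoulli n = INR (fact n) * bcoef n.
Proof.
induction n as [n IH] using lt_wf_ind.
destruct n as [|n]; [unfold bernoulli; simpl; ring|].
assert (H1 := bernoulli_rec (S n) ltac:(lia)).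
assert (H2 := bcoef_rec (S n) ltac:(lia)).
rewrite sum_n_S in H1, H2.
rewrite (sum_n_ext_loc _ (fun k => INR (fact (S (S n))) * (bcoef k * / INR (fact (S (S n - k)))))) in H1.
2:{ intros k Hk; rewrite IH by lia; unfold Binomial.C.
    replace (S (S n) - k)%nat with (S (S n - k)) by lia.
    real_eq.
    field; split; apply INR_fact_neq_0. }
rewrite sum_n_Rmult_l in H1.
set (T := sum_n _ n) in *.
unfold Binomial.C in H1.
replace (S (S n) - S n)%nat with 1%nat in H1 by lia.
rewrite Nat.sub_diag in H2.
change (fact 1) with 1%nat in *; change (INR 1) with 1 in *.
rewrite Rinv_1, Rmult_1_r in H2; rewrite Rmult_1_r in H1.
replace T with (- bcoef (S n)) in H1 by lra.
assert (Hf1 := INR_fact_neq_0 (S n)); assert (Hf2 := INR_fact_neq_0 (S (S n))).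
apply (Rmult_eq_reg_l (INR (fact (S (S n))))); [|easy].
apply (Rmult_eq_reg_r (/ INR (fact (S n)))); [|now apply Rinv_neq_0_compat].
replace (INR (fact (S (S n))) * (INR (fact (S n)) * bcoef (S n)) * / INR (fact (S n)))
  with (INR (fact (S (S n))) * bcoef (S n)) by (field; easy).
unfold Rdiv in H1; lra.
Qed.

Lemma cyc_odd_0 (k : nat) : cyc (2 * k + 1) 0 = 0.
Proof.
induction k as [|k IH]; [simpl; rewrite sin_0; ring|].
replace (2 * S k + 1)%nat with (S (S (2 * k + 1))) by lia.
simpl cyc in *; rewrite IH; ring.
Qed.

Lemma cyc_even_0 (k : nat) : cyc (2 * k) 0 = (-1) ^ (k + 1).
Proof.
induction k as [|k IH]; [simpl; rewrite cos_0; ring|].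
replace (2 * S k)%nat with (S (S (2 * k))) by lia.
cbn [cyc]; rewrite IH; simpl; ring.
Qed.

Lemma kernel_odd_0 (k : nat) : kernel (2 * k + 1) 0 = 0.
Proof.
unfold kernel; rewrite (Series_ext _ (fun n => 0 * 0)).
- rewrite Series_scal_l; ring.
- intros n; rewrite Rmult_0_r, cyc_odd_0; unfold Rdiv; ring.
Qed.

Lemma zeta_INR (s : nat) : zeta (INR s) = Series (fun n => / INR (S n) ^ s).
Proof.
apply Series_ext; intros n; rewrite Rpower_pow; [easy|apply lt_0_INR; lia].
Qed.

Lemma kernel_even_0 (k : nat) :
  kernel (2 * k) 0 = (-1) ^ (k + 1) * 2 * zeta (INR (2 * k)) / (2 * PI) ^ (2 * k).
Proof.
unfold kernel; rewrite zeta_INR.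
unfold Rdiv; rewrite (Rmult_comm _ (/ _)), <- Rmult_assoc, <- Series_scal_l.
apply Series_ext; intros n; rewrite Rmult_0_r, cyc_even_0.
unfold freq; rewrite Rpow_mult_distr; assert (HP := PI_RGT_0).
field; split; apply pow_nonzero; [apply not_0_INR; lia|lra].
Qed.

(** * Functions with controlled derivatives *)

(** One predicate for two uses: mere n-fold differentiability on the line ([smoothR]), and decay of
    all derivatives up to order n on the half-line t > 0 ([rapid_smooth]). Closure under sums and
    products is then a single induction, with derivatives given existentially; [smooth_Derive_n]
    returns to [Derive_n]. *)
Fixpoint smooth (P : (R -> R) -> Prop) (U : R -> Prop) (n : nat) (f : R -> R) : Prop :=
  P f /\ match n with
         | O => True
         | S m => exists f' : R -> R,
             (forall t : R, U t -> is_derive f t (f' t)) /\ smooth P U m f'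
         end.

Lemma smooth_S (P : (R -> R) -> Prop) (U : R -> Prop) (n : nat) (f f' : R -> R) :
  P f -> (forall t : R, U t -> is_derive f t (f' t)) -> smooth P U n f' ->
  smooth P U (S n) f.
Proof. intros Hf Hd Hn; split; [easy|now exists f']. Qed.

Lemma smooth_0 (P : (R -> R) -> Prop) (U : R -> Prop) (n : nat) (f : R -> R) :
  smooth P U n f -> P f.
Proof. now destruct n; intros [H _]. Qed.

Lemma smooth_pred (P : (R -> R) -> Prop) (U : R -> Prop) (n : nat) (f : R -> R) :
  smooth P U (S n) f -> smooth P U n f.
Proof.
revert f; induction n as [|n IH]; intros f [Hf [f' [Hd Hn]]]; [easy|].
split; [easy|]; exists f'; split; [easy|now apply IH].
Qed.

Lemma smooth_ext (P : (R -> R) -> Prop) (U : R -> Prop)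
    (HE : forall f g, (forall t, f t = g t) -> P f -> P g) (n : nat) (f g : R -> R) :
  (forall t, f t = g t) -> smooth P U n f -> smooth P U n g.
Proof.
intros Hfg Hf; destruct n as [|n]; (split; [apply (HE f); [easy|apply Hf]|]); [easy|].
destruct Hf as [_ [f' [Hd Hn]]]; exists f'; split; [|easy].
intros t Ht; apply (is_derive_ext f); [easy|now apply Hd].
Qed.

Lemma smooth_plus (P : (R -> R) -> Prop) (U : R -> Prop)
    (HP : forall f g, P f -> P g -> P (fun t => f t + g t))
    (n : nat) (f g : R -> R) :
  smooth P U n f -> smooth P U n g -> smooth P U n (fun t => f t + g t).
Proof.
revert f g; induction n as [|n IH]; intros f g [Hf Hf'] [Hg Hg'].
- split; [now apply HP|easy].
- destruct Hf' as [f' [Hdf Hnf]]; destruct Hg' as [g' [Hdg Hng]].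
  apply (smooth_S _ _ _ _ (fun t => f' t + g' t)); [now apply HP| |now apply IH].
  intros t Ht; apply (is_derive_plus (V := R_NormedModule)); auto.
Qed.

Lemma smooth_mult (P : (R -> R) -> Prop) (U : R -> Prop)
    (HP : forall f g, P f -> P g -> P (fun t => f t + g t))
    (HM : forall f g, P f -> P g -> P (fun t => f t * g t))
    (n : nat) (f g : R -> R) :
  smooth P U n f -> smooth P U n g -> smooth P U n (fun t => f t * g t).
Proof.
revert f g; induction n as [|n IH]; intros f g Hf Hg.
- split; [apply HM; [apply Hf|apply Hg]|easy].
- assert (Hf1 := smooth_pred _ _ _ _ Hf); assert (Hg1 := smooth_pred _ _ _ _ Hg).
  destruct Hf as [Pf [f' [Hdf Hnf]]]; destruct Hg as [Pg [g' [Hdg Hng]]].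
  apply (smooth_S _ _ _ _ (fun t => f' t * g t + f t * g' t)); [now apply HM| |].
  + intros t Ht; apply (is_derive_mult (K := R_AbsRing)); auto.
    intros; apply Rmult_comm.
  + now apply smooth_plus; [|apply IH|apply IH].
Qed.

Lemma smooth_scal (P : (R -> R) -> Prop) (U : R -> Prop)
    (HS : forall c f, P f -> P (fun t => c * f t)) (n : nat) (c : R) (f : R -> R) :
  smooth P U n f -> smooth P U n (fun t => c * f t).
Proof.
revert f; induction n as [|n IH]; intros f [Pf Hf].
- split; [now apply HS|easy].
- destruct Hf as [f' [Hdf Hnf]].
  apply (smooth_S _ _ _ _ (fun t => c * f' t)); [now apply HS| |now apply IH].
  intros t Ht; apply is_derive_scal; auto.
Qed.

Lemma smooth_mult_id (P : (R -> R) -> Prop) (U : R -> Prop)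
    (HP : forall f g, P f -> P g -> P (fun t => f t + g t))
    (HI : forall f, P f -> P (fun t => t * f t)) (n : nat) (f : R -> R) :
  smooth P U n f -> smooth P U n (fun t => t * f t).
Proof.
revert f; induction n as [|n IH]; intros f Hf.
- split; [apply HI, Hf|easy].
- assert (Hf1 := smooth_pred _ _ _ _ Hf).
  destruct Hf as [Pf [f' [Hdf Hnf]]].
  apply (smooth_S _ _ _ _ (fun t => f t + t * f' t)); [now apply HI| |].
  + intros t Ht; evar_last.
    * apply (is_derive_mult (K := R_AbsRing) (fun t => t) f t 1); auto.
      -- apply (is_derive_id (K := R_AbsRing)).
      -- intros; apply Rmult_comm.
    * unfold plus, mult; simpl; ring.
  + now apply smooth_plus; [| |apply IH].
Qed.

(** Agreement on the open set [U] is enough, since derivatives are local. This transfers decay from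
    a formula singular at 0 to the function that extends it. *)
Lemma smooth_Derive_n (P : (R -> R) -> Prop) (U : R -> Prop)
    (HU : forall t : R, U t -> locally t U)
    (HE : forall f g, (forall t, U t -> f t = g t) -> P f -> P g)
    (n i : nat) (f g : R -> R) :
  smooth P U n f -> (forall t, U t -> f t = g t) -> (i <= n)%nat ->
  P (Derive_n g i) /\
  ((i < n)%nat -> forall t, U t -> ex_derive (Derive_n g i) t).
Proof.
revert n f g; induction i as [|i IH]; intros n f g Hf Hfg Hi.
- split; [apply (HE f); [easy|now apply (smooth_0 P U n)]|].
  intros Hn t Ht; destruct n as [|n]; [lia|].
  destruct Hf as [_ [f' [Hd _]]]; exists (f' t).
  apply (is_derive_ext_loc f); [|now apply Hd].
  apply (filter_imp U); [easy|now apply HU].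
- destruct n as [|n]; [lia|]; destruct Hf as [_ [f' [Hd Hn]]].
  assert (Hg : forall t, U t -> f' t = Derive g t).
  { intros t Ht; symmetry; apply is_derive_unique, (is_derive_ext_loc f); [|now apply Hd].
    apply (filter_imp U); [easy|now apply HU]. }
  destruct (IH n f' (Derive g) Hn Hg ltac:(lia)) as [H1 H2].
  assert (Heq : forall t, Derive_n (Derive g) i t = Derive_n g (S i) t).
  { intros t; replace (S i) with (i + 1)%nat by lia.
    now rewrite <- Derive_n_comp. }
  split.
  + apply (HE (Derive_n (Derive g) i)); [intros t _; apply Heq|easy].
  + intros Hin t Ht; apply (ex_derive_ext (Derive_n (Derive g) i)); [apply Heq|].
    apply H2; [lia|easy].
Qed.

Definition smoothR : nat -> (R -> R) -> Prop := smooth (fun _ => True) (fun _ => True).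

Lemma smoothR_const (n : nat) (c : R) : smoothR n (fun _ => c).
Proof.
revert c; induction n as [|n IH]; intros c; [easy|].
apply (smooth_S _ _ _ _ (fun _ => 0)); [easy| |apply IH].
intros t _; apply (is_derive_const (V := R_NormedModule)).
Qed.

Lemma smoothR_mult (n : nat) (f g : R -> R) :
  smoothR n f -> smoothR n g -> smoothR n (fun t => f t * g t).
Proof. now apply smooth_mult. Qed.

Lemma smoothR_pow (n k : nat) : smoothR n (fun t => t ^ k).
Proof.
induction k as [|k IH]; [exact (smoothR_const n 1)|].
exact (smooth_mult_id (fun _ => True) (fun _ => True) (fun _ _ _ _ => I) (fun _ _ => I) n _ IH).
Qed.

Lemma smoothR_inv (n : nat) (f : R -> R) :
  (forall t, f t <> 0) -> smoothR n f -> smoothR n (fun t => / f t).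
Proof.
intros Hne; induction n as [|n IH]; intros Hf; [easy|].
assert (Hf1 := smooth_pred _ _ _ _ Hf); destruct Hf as [_ [f' [Hd Hn]]].
apply (smooth_S _ _ _ _ (fun t => -1 * (f' t * (/ f t * / f t)))); [easy| |].
- intros t _; evar_last; [apply is_derive_inv; [now apply Hd|apply Hne]|].
  field; apply Hne.
- apply smooth_scal; [easy|].
  apply smoothR_mult; [easy|now apply smoothR_mult; apply IH].
Qed.

Lemma smoothR_comp (n : nat) (f p : R -> R) :
  smoothR n f -> smoothR n p -> smoothR n (fun t => f (p t)).
Proof.
revert f; induction n as [|n IH]; intros f Hf Hp; [easy|].
assert (Hp1 := smooth_pred _ _ _ _ Hp); destruct Hp as [_ [p' [Hdp Hnp]]].
destruct Hf as [_ [f' [Hd Hn]]].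
apply (smooth_S _ _ _ _ (fun t => p' t * f' (p t))); [easy| |].
- intros t _; apply (is_derive_comp f p); [now apply Hd|now apply Hdp].
- apply smoothR_mult; [easy|now apply IH].
Qed.

Lemma smoothR_PSeries (n : nat) (a : nat -> R) :
  CV_radius a = p_infty -> smoothR n (PSeries a).
Proof.
revert a; induction n as [|n IH]; intros a Ha; [easy|].
apply (smooth_S _ _ _ _ (PSeries (PS_derive a))); [easy| |].
- intros t _; apply is_derive_PSeries; now rewrite Ha.
- apply IH; now rewrite CV_radius_derive.
Qed.

(** Only t >= 1 is constrained, because 1 / (exp (t^N) - 1) blows up at 0; the compact remainder is
    left to continuity. *)
Definition rapid (f : R -> R) : Prop :=
  forall k : nat, exists C, forall t, 1 <= t -> Rabs (f t) * t ^ k <= C.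

Lemma rapid_ext (f g : R -> R) : (forall t, f t = g t) -> rapid f -> rapid g.
Proof.
intros Hfg Hf k; destruct (Hf k) as [C HC]; exists C; intros t Ht.
rewrite <- Hfg; now apply HC.
Qed.

Lemma rapid_plus (f g : R -> R) : rapid f -> rapid g -> rapid (fun t => f t + g t).
Proof.
intros Hf Hg k; destruct (Hf k) as [C HC]; destruct (Hg k) as [D HD].
exists (C + D); intros t Ht; specialize (HC t Ht); specialize (HD t Ht).
assert (H := Rabs_triang (f t) (g t)).
assert (Hp : 0 <= t ^ k) by (apply pow_le; lra); nra.
Qed.

Lemma rapid_mult (f g : R -> R) : rapid f -> rapid g -> rapid (fun t => f t * g t).
Proof.
intros Hf Hg k; destruct (Hf k) as [C HC]; destruct (Hg 0%nat) as [D HD].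
exists (C * D); intros t Ht; specialize (HC t Ht); specialize (HD t Ht).
simpl in HD; rewrite Rmult_1_r in HD.
rewrite Rabs_mult, Rmult_assoc, (Rmult_comm (Rabs (g t))), <- Rmult_assoc.
apply Rmult_le_compat; [|apply Rabs_pos|easy..].
apply Rmult_le_pos; [apply Rabs_pos|apply pow_le; lra].
Qed.

Lemma rapid_scal (c : R) (f : R -> R) : rapid f -> rapid (fun t => c * f t).
Proof.
intros Hf k; destruct (Hf k) as [C HC]; exists (Rabs c * C); intros t Ht.
rewrite Rabs_mult, Rmult_assoc.
apply Rmult_le_compat_l; [apply Rabs_pos|now apply HC].
Qed.

Lemma rapid_mult_id (f : R -> R) : rapid f -> rapid (fun t => t * f t).
Proof.
intros Hf k; destruct (Hf (S k)) as [C HC]; exists C; intros t Ht.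
rewrite Rabs_mult, (Rabs_pos_eq t) by lra.
specialize (HC t Ht); simpl in HC; lra.
Qed.

Definition rapid_smooth : nat -> (R -> R) -> Prop := smooth rapid (fun t => 0 < t).

Lemma rapid_smooth_mult_pow (n k : nat) (f : R -> R) :
  rapid_smooth n f -> rapid_smooth n (fun t => t ^ k * f t).
Proof.
intros Hf; induction k as [|k IH].
- apply (smooth_scal _ _ rapid_scal n 1 f Hf).
- assert (H := smooth_mult_id _ _ rapid_plus rapid_mult_id n _ IH).
  refine (smooth_ext _ _ rapid_ext n _ _ _ H); intros t; simpl; ring.
Qed.

(** * The summand of the logarithmic derivative *)

(* [(exp u - 1) / u], extended analytically to [u = 0]. *)
Definition expm1_div (u : R) : R := PSeries (PS_decr_1 (fun n => / INR (fact n))) u.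

Lemma CV_radius_exp : CV_radius (fun n => / INR (fact n)) = p_infty.
Proof.
apply CV_radius_infinite_DAlembert.
- intros n; apply Rinv_neq_0_compat, INR_fact_neq_0.
- apply (is_lim_seq_ext (fun n => / INR (S n))).
  + intros n; rewrite fact_simpl, mult_INR.
    assert (H1 : 0 < / INR (S n)) by (apply Rinv_0_lt_compat, lt_0_INR; lia).
    rewrite <- (Rabs_pos_eq (/ INR (S n))) by lra; f_equal; field.
    split; [apply INR_fact_neq_0|apply not_0_INR; lia].
  + apply (is_lim_seq_incr_1 (fun n => / INR n) 0).
    apply (is_lim_seq_inv INR p_infty); [apply is_lim_seq_INR | easy].
Qed.

Lemma expm1_div_mult (u : R) : u * expm1_div u = exp u - 1.
Proof.
assert (H := is_pseries_unique _ _ _ (is_exp_Reals u)).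
rewrite PSeries_decr_1 in H by (eexists; apply is_exp_Reals).
unfold expm1_div; simpl in H; lra.
Qed.

Lemma expm1_div_neq_0 (u : R) : expm1_div u <> 0.
Proof.
intros H; destruct (Req_dec u 0) as [->|Hu].
- unfold expm1_div in H; rewrite PSeries_0 in H; unfold PS_decr_1 in H; simpl in H; lra.
- assert (H1 := expm1_div_mult u); rewrite H in H1.
  assert (H2 := exp_ineq1 u Hu); rewrite Rmult_0_r in H1.
  apply Hu, exp_inv; rewrite exp_0; lra.
Qed.

Section Summand.

Variable N : nat.
Hypothesis HN : (1 <= N)%nat.

(** The function h of the overview. The quotient t^(3N-1) / (exp (t^N) - 1) reads 0/0 at the origin;
    this form is smooth there. *)
Definition summand (t : R) : R := t ^ (2 * N - 1) * / expm1_div (t ^ N).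

Lemma summand_pos (t : R) : 0 < t -> summand t = t ^ (3 * N - 1) * / (exp (t ^ N) - 1).
Proof.
intros Ht; unfold summand; rewrite <- expm1_div_mult.
assert (H1 := expm1_div_neq_0 (t ^ N)).
assert (H2 : t ^ N <> 0) by (apply pow_nonzero; lra).
replace (3 * N - 1)%nat with (2 * N - 1 + N)%nat by lia.
rewrite pow_add; field; easy.
Qed.

Lemma summand_smooth (n : nat) : smoothR n summand.
Proof.
apply smoothR_mult; [apply smoothR_pow|].
apply (smoothR_comp n (fun u => / expm1_div u) (fun t => t ^ N)); [|apply smoothR_pow].
apply smoothR_inv; [apply expm1_div_neq_0|].
apply smoothR_PSeries; rewrite CV_radius_decr_1; apply CV_radius_exp.
Qed.

Definition summand_d (i : nat) (t : R) : R := Derive_n summand i t.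

Lemma is_derive_summand_d (i : nat) (t : R) :
  is_derive (summand_d i) t (summand_d (S i) t).
Proof.
apply Derive_correct.
destruct (smooth_Derive_n (fun _ => True) (fun _ => True)
  (fun t _ => filter_true) (fun _ _ _ _ => I) (S i) i summand summand
  (summand_smooth (S i)) (fun _ _ => eq_refl) ltac:(lia)) as [_ H].
apply H; [lia|easy].
Qed.

Lemma exp_decay_rapid : rapid (fun t => / (exp (t ^ N) - 1)).
Proof.
intros k; exists (INR (fact (S k))); intros t Ht.
assert (Htn : t <= t ^ N) by (rewrite <- (pow_1 t) at 1; apply Rle_pow; [lra|easy]).
assert (H1 : 0 < exp (t ^ N) - 1) by (apply exp_minus_1_pos; lra).
rewrite Rabs_pos_eq by (left; now apply Rinv_0_lt_compat).
apply (Rmult_le_reg_l (exp (t ^ N) - 1)); [easy|].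
rewrite <- Rmult_assoc, Rinv_r, Rmult_1_l by lra.
assert (H2 := exp_ge_pow k (t ^ N) ltac:(lra)).
assert (Hf := INR_fact_lt_0 (S k)).
assert (H3 : (t ^ N) ^ S k <= (exp (t ^ N) - 1) * INR (fact (S k))).
{ apply (Rmult_le_compat_r (INR (fact (S k)))) in H2; [|lra].
  unfold Rdiv in H2; rewrite Rmult_assoc, Rinv_l, Rmult_1_r in H2 by lra; easy. }
eapply Rle_trans; [|exact H3].
apply Rle_trans with (t ^ S k); [apply Rle_pow; [lra|lia]|apply pow_incr; lra].
Qed.

(* With [w = 1 / (exp (t ^ N) - 1)] one has [w' = - N t ^ (N - 1) (w + w ^ 2)]. *)
Lemma exp_decay_rapid_smooth (n : nat) : rapid_smooth n (fun t => / (exp (t ^ N) - 1)).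
Proof.
induction n as [|n IH].
- split; [apply exp_decay_rapid|easy].
- apply (smooth_S _ _ _ _ (fun t => - INR N * (t ^ (N - 1) *
    (/ (exp (t ^ N) - 1) + / (exp (t ^ N) - 1) * / (exp (t ^ N) - 1)))));
    [apply exp_decay_rapid| |].
  + intros t Ht.
    assert (Hp : 0 < t ^ N) by now apply pow_lt.
    assert (H1 := exp_minus_1_pos _ Hp).
    evar_last.
    * apply is_derive_inv; [|lra].
      apply (is_derive_minus (V := R_NormedModule) (fun t => exp (t ^ N)) (fun _ => 1));
        [|apply (is_derive_const (V := R_NormedModule))].
      apply (is_derive_comp exp (fun t => t ^ N)); [apply is_derive_exp|].
      apply (is_derive_pow (fun t => t) N t 1), (is_derive_id (K := R_AbsRing)).
    * unfold minus, plus, opp, zero, scal; cbn -[INR pow exp].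
      unfold mult; cbn -[INR pow exp].
      replace (pred N) with (N - 1)%nat by lia.
      field; lra.
  + apply smooth_scal; [exact rapid_scal|].
    apply rapid_smooth_mult_pow.
    apply smooth_plus; [exact rapid_plus|easy|].
    apply smooth_mult; [exact rapid_plus|exact rapid_mult|easy..].
Qed.

Lemma summand_d_rapid (i : nat) : rapid (summand_d i).
Proof.
apply (smooth_Derive_n rapid (fun t => 0 < t)) with (n := i)
  (f := fun t => t ^ (3 * N - 1) * / (exp (t ^ N) - 1)).
- intros t Ht; apply (open_gt 0 t Ht).
- intros f g Hfg Hf k; destruct (Hf k) as [C HC]; exists C; intros t Ht.
  rewrite <- Hfg by lra; now apply HC.
- apply rapid_smooth_mult_pow, exp_decay_rapid_smooth.
- intros t Ht; now rewrite summand_pos.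
- easy.
Qed.

Lemma summand_d_bound (i : nat) :
  exists C, 0 <= C /\ forall t, 0 <= t -> Rabs (summand_d i t) <= C / (1 + t ^ 2).
Proof.
destruct (continuity_ab_maj (fun t => Rabs (summand_d i t)) 0 1) as [m [Hm _]]; [lra| |].
{ intros t _; apply continuity_pt_filterlim.
  apply (continuous_comp (summand_d i) Rabs); [|apply continuous_Rabs].
  apply (ex_derive_continuous (K := R_AbsRing) (V := R_NormedModule)).
  eexists; apply is_derive_summand_d. }
destruct (summand_d_rapid i 2%nat) as [C HC].
set (A := Rabs (summand_d i m)) in *.
assert (HA : 0 <= A) by apply Rabs_pos.
assert (HC0 : 0 <= C).
{ eapply Rle_trans; [|apply (HC 1); lra].
  apply Rmult_le_pos; [apply Rabs_pos|lra]. }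
(* The factor 2 covers both ranges: 1 + t^2 <= 2 for t <= 1, and 1 + t^2 <= 2 t^2 beyond. *)
exists (2 * (A + C)); split; [lra|]; intros t Ht.
assert (Hp := Rabs_pos (summand_d i t)).
apply (Rmult_le_reg_r (1 + t ^ 2)); [nra|].
unfold Rdiv; rewrite Rmult_assoc, Rinv_l, Rmult_1_r by nra.
destruct (Rle_dec t 1) as [Ht1|Ht1].
- assert (H := Hm t ltac:(lra)); assert (t ^ 2 <= 1) by nra; nra.
- assert (H := HC t ltac:(lra)); assert (1 <= t ^ 2) by nra; nra.
Qed.

Lemma is_lim_summand_d (i : nat) : is_lim (summand_d i) p_infty 0.
Proof.
destruct (summand_d_bound i) as [C [_ HC]]; now apply (is_lim_inv_sqr_bound _ C).
Qed.

Lemma sum_n_sparse (s : nat -> R) (K : nat) :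
  (forall m, (m mod N <> 0)%nat -> s m = 0) ->
  sum_n s (N * K) = sum_n (fun k => s (N * k)%nat) K.
Proof.
intros Hs; induction K as [|K IH].
- rewrite Nat.mul_0_r, !sum_O; now rewrite Nat.mul_0_r.
- rewrite sum_n_S, <- IH.
  assert (Hblock : forall i, (i < N)%nat -> sum_n s (N * K + i) = sum_n s (N * K)).
  { induction i as [|i IHi]; intros Hi; [now rewrite Nat.add_0_r|].
    rewrite Nat.add_succ_r, sum_n_S, IHi by lia; rewrite Hs; [apply Rplus_0_r|].
    replace (S (N * K + i)) with (S i + K * N)%nat by lia.
    rewrite Nat.Div0.mod_add, Nat.mod_small; lia. }
  replace (N * S K)%nat with (S (N * K + (N - 1))) at 1 by lia.
  rewrite sum_n_S, Hblock by lia.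
  do 2 f_equal; lia.
Qed.

(* Taylor coefficients of [summand]: [t ^ (N (k + 2) - 1)] has coefficient [bcoef k]. *)
Definition summand_coef (n : nat) : R :=
  if (S n mod N =? 0)%nat then
    if (2 * N <=? S n)%nat then bcoef (S n / N - 2) else 0
  else 0.

Lemma summand_coef_mult (k : nat) : summand_coef (N * (k + 2) - 1) = bcoef k.
Proof.
unfold summand_coef.
replace (S (N * (k + 2) - 1)) with ((k + 2) * N)%nat by nia.
rewrite Nat.Div0.mod_mul, Nat.eqb_refl, Nat.div_mul by lia.
rewrite (proj2 (Nat.leb_le _ _)) by nia.
f_equal; lia.
Qed.

Lemma summand_coef_small (n : nat) : (S n < 2 * N)%nat -> summand_coef n = 0.
Proof.
intros Hn; unfold summand_coef; rewrite (proj2 (Nat.leb_gt _ _)) by lia.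
now destruct (_ =? _)%nat.
Qed.

(** Reindexes a sparse sum over the multiples of N; the multiples 0 and N contribute nothing. The
    weight [g] is arbitrary because the lemma serves both for powers of t and for the
    Euler-Maclaurin terms. *)
Lemma summand_coef_sum (g : nat -> R) (K : nat) :
  sum_n (fun n => summand_coef n * g (S n)) (N * (K + 2) - 1)
  = sum_n (fun k => bcoef k * g (N * (k + 2))%nat) K.
Proof.
set (s := fun m => match m with O => 0 | S n => summand_coef n * g (S n) end).
assert (H := sum_n_sparse s (K + 2)).
replace (N * (K + 2))%nat with (S (N * (K + 2) - 1)) in H by nia.
rewrite sum_n_shift in H; simpl (s 0%nat) in H.
replace (K + 2)%nat with (S (S K)) in H at 2 by lia.
rewrite !sum_n_shift in H.
rewrite Nat.mul_0_r, Nat.mul_1_r in H.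
assert (HsN : s N = 0).
{ replace N with (S (N - 1)) by lia; simpl; rewrite summand_coef_small by lia; ring. }
rewrite HsN in H; simpl (s 0%nat) in H; rewrite !Rplus_0_l in H.
transitivity (sum_n (fun k => s (S k)) (N * (K + 2) - 1)); [easy|].
rewrite H.
- apply sum_n_ext; intros k; rewrite <- summand_coef_mult.
  replace (N * S (S k))%nat with (S (N * (k + 2) - 1)) by nia.
  unfold s; do 2 f_equal; nia.
- intros m Hm; unfold s; destruct m as [|n]; [easy|].
  unfold summand_coef; rewrite (proj2 (Nat.eqb_neq _ _)) by easy; ring.
Qed.

(** The Bernoulli expansion at u = t^N, multiplied by t^(2N-1). In the error this factor is weakened
    to t^N, which makes the exponent exactly N (M + 2). *)
Lemma summand_expands : expands summand summand_coef.
Proof.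
intros M.
apply (expands_upto_le _ _ M (N * (M + 2) - 1)); [nia|].
destruct (bernoulli_function_expands M) as [C HC].
exists C; intros t Ht.
rewrite (sum_n_ext _ (fun n => summand_coef n * t ^ (S n - 1)))
  by (intros n; do 2 f_equal; lia).
rewrite (summand_coef_sum (fun m => t ^ (m - 1))).
assert (Hu : 0 < t ^ N <= 1).
{ split; [apply pow_lt; lra|rewrite <- (pow1 N); apply pow_incr; lra]. }
specialize (HC _ Hu).
assert (Hp : 0 < t ^ (2 * N - 1)) by (apply pow_lt; lra).
assert (Hp1 : t ^ (2 * N - 1) <= t ^ N) by (apply pow_le_pow; [easy|lia]).
rewrite summand_pos by lra.
replace (sum_n _ M) with (t ^ (2 * N - 1) * sum_n (fun m => bcoef m * (t ^ N) ^ m) M).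
2:{ rewrite <- sum_n_Rmult_l; apply sum_n_ext; intros k.
    rewrite <- pow_mult, <- Rmult_assoc, (Rmult_comm _ (bcoef k)), Rmult_assoc, <- pow_add.
    do 2 f_equal; nia. }
replace (3 * N - 1)%nat with (2 * N - 1 + N)%nat by lia.
rewrite pow_add, Rmult_assoc, <- Rmult_minus_distr_l, Rabs_mult, (Rabs_pos_eq _ (Rlt_le _ _ Hp)).
assert (HC0 : 0 <= C * (t ^ N) ^ S M) by (eapply Rle_trans; [apply Rabs_pos|exact HC]).
apply Rle_trans with (t ^ N * (C * (t ^ N) ^ S M)).
- apply Rmult_le_compat; [lra|apply Rabs_pos|easy|exact HC].
- right; rewrite <- pow_mult, (Rmult_comm C), <- Rmult_assoc, <- pow_add, Rmult_comm.
  do 2 f_equal; nia.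
Qed.

(** Uniqueness of expansions reads the derivatives at 0 off the series, without differentiating the
    composite function. *)
Lemma summand_d_0 (m : nat) : summand_d m 0 = INR (fact m) * summand_coef m.
Proof.
assert (H := expands_unique _ _ _ (expands_taylor summand_d is_derive_summand_d)
  summand_expands m).
rewrite <- H; field; apply INR_fact_neq_0.
Qed.

End Summand.

(** * The integral of the summand *)

Section SummandIntegral.

Variable N : nat.
Hypothesis HN : (1 <= N)%nat.

Definition summand_int (t : R) : R := RInt (summand N) 0 t.

Lemma continuous_summand (t : R) : continuous (summand N) t.
Proof.
apply (ex_derive_continuous (K := R_AbsRing) (V := R_NormedModule)).
eexists; exact (is_derive_summand_d N HN 0%nat t).
Qed.

Lemma is_derive_summand_int (t : R) : is_derive summand_int t (summand N t).
Proof.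
apply (is_derive_RInt _ _ 0); [|apply continuous_summand].
apply filter_forall; intros s; apply (RInt_correct (V := R_CompleteNormedModule)).
apply (ex_RInt_continuous (V := R_CompleteNormedModule)); intros; apply continuous_summand.
Qed.

Lemma geom_exp_sum (K : nat) (u : R) : 0 < u ->
  / (exp u - 1) - sum_n (fun k => exp (- (INR (S k) * u))) K
  = exp (- (INR (S K) * u)) / (exp u - 1).
Proof.
intros Hu; assert (H := exp_minus_1_pos u Hu).
assert (Hstep : forall k, exp (- (INR k * u)) = exp u * exp (- (INR (S k) * u))).
{ intros k; rewrite <- exp_plus, S_INR; f_equal; ring. }
induction K as [|K IH].
- rewrite sum_O.
  assert (H0 := Hstep 0%nat); simpl (INR 0) in H0; rewrite Rmult_0_l, Ropp_0, exp_0 in H0.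
  apply (Rmult_eq_reg_r (exp u - 1)); [|lra].
  replace ((/ (exp u - 1) - exp (- (INR 1 * u))) * (exp u - 1))
    with (1 - exp u * exp (- (INR 1 * u)) + exp (- (INR 1 * u))) by (field; lra).
  rewrite <- H0; field; lra.
- rewrite sum_n_S.
  replace (/ (exp u - 1) - (sum_n (fun k => exp (- (INR (S k) * u))) K
             + exp (- (INR (S (S K)) * u))))
    with ((/ (exp u - 1) - sum_n (fun k => exp (- (INR (S k) * u))) K)
          - exp (- (INR (S (S K)) * u))) by ring.
  rewrite IH, (Hstep (S K)); field; lra.
Qed.

(** Primitive of t^(3N-1) exp (- k t^N), the k-th term of the summand in its geometric expansion;
    [D] below is the primitive of t^(2N-1) exp (- k t^N), which controls the tail. *)
Let A (k : R) (t : R) : R :=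
  - / INR N * (exp (- (k * t ^ N))
     * ((t ^ N) ^ 2 / k + 2 * t ^ N / k ^ 2 + 2 / k ^ 3)).

Let D (k : R) (t : R) : R :=
  - / INR N * (exp (- (k * t ^ N)) * (t ^ N / k + 1 / k ^ 2)).

Lemma is_derive_of_pow (f : R -> R) (df t : R) :
  is_derive f (t ^ N) df -> is_derive (fun t => f (t ^ N)) t (INR N * t ^ (N - 1) * df).
Proof.
intros Hf; evar_last.
- apply (is_derive_comp f (fun t => t ^ N)); [exact Hf|].
  apply (is_derive_pow (fun t => t) N t 1), (is_derive_id (K := R_AbsRing)).
- unfold scal; cbn -[INR pow]; unfold mult; cbn -[INR pow].
  replace (pred N) with (N - 1)%nat by lia; ring.
Qed.

Lemma is_derive_A (k t : R) : 0 < k ->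
  is_derive (A k) t (t ^ (3 * N - 1) * exp (- (k * t ^ N))).
Proof.
intros Hk; unfold A.
assert (HN0 : INR N <> 0) by (apply not_0_INR; lia).
evar_last.
- apply (is_derive_of_pow (fun u => - / INR N * (exp (- (k * u))
     * (u ^ 2 / k + 2 * u / k ^ 2 + 2 / k ^ 3)))).
  auto_derive; [trivial|reflexivity].
- replace (3 * N - 1)%nat with (N - 1 + N * 2)%nat by lia.
  rewrite pow_add, pow_mult; simpl; field; lra.
Qed.

Lemma is_derive_D (k t : R) : 0 < k ->
  is_derive (D k) t (t ^ (2 * N - 1) * exp (- (k * t ^ N))).
Proof.
intros Hk; unfold D.
assert (HN0 : INR N <> 0) by (apply not_0_INR; lia).
evar_last.
- apply (is_derive_of_pow (fun u => - / INR N * (exp (- (k * u)) * (u / k + 1 / k ^ 2)))).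
  auto_derive; [trivial|reflexivity].
- replace (2 * N - 1)%nat with (N - 1 + N)%nat by lia.
  rewrite pow_add; simpl; field; lra.
Qed.

(** Since u / (exp u - 1) <= 1 with u = t^N, the geometric tail is at most t^(2N-1) exp (- (K+1) u),
    whose integral is bounded by - D(0) = 1 / (N (K+1)^2). *)
Lemma summand_int_approx (K : nat) (T : R) : 0 <= T ->
  Rabs (summand_int T
        - sum_n (fun k => A (INR (S k)) T - A (INR (S k)) 0) K)
  <= / INR (S K) ^ 2.
Proof.
intros HT.
assert (HS : forall k, 1 <= INR (S k)) by (intros k; apply (le_INR 1); lia).
assert (HN1 : 1 <= INR N) by (apply (le_INR 1); lia).
assert (H : Rabs ((summand_int T - sum_n (fun k => A (INR (S k)) T) K)
                  - (summand_int 0 - sum_n (fun k => A (INR (S k)) 0) K))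
            <= D (INR (S K)) T - D (INR (S K)) 0).
{ assert (Hd : forall t, is_derive
    (fun t => summand_int t - sum_n (fun k => A (INR (S k)) t) K) t
    (summand N t - sum_n (fun k => t ^ (3 * N - 1) * exp (- (INR (S k) * t ^ N))) K)).
  { intros t; apply (is_derive_minus (V := R_NormedModule)); [apply is_derive_summand_int|].
    apply (is_derive_sum_n (fun k => A (INR (S k)))); intros k _.
    apply is_derive_A; specialize (HS k); lra. }
  assert (HD : forall t, is_derive (D (INR (S K))) t
    (t ^ (2 * N - 1) * exp (- (INR (S K) * t ^ N)))).
  { intros t; apply is_derive_D; specialize (HS K); lra. }
  apply (increment_le (fun t => summand_int t - sum_n (fun k => A (INR (S k)) t) K)
    _ (D (INR (S K))) _ 0 T HT (fun t _ => Hd t) (fun t _ => HD t)).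
  - intros t _; apply (ex_derive_continuous (K := R_AbsRing) (V := R_NormedModule)).
    eexists; apply Hd.
  - intros t _; apply (ex_derive_continuous (K := R_AbsRing) (V := R_NormedModule)).
    eexists; apply HD.
  - intros t Ht.
    assert (Hp : 0 < t ^ N) by (apply pow_lt; lra).
    assert (Hp2 : 0 < t ^ (2 * N - 1)) by (apply pow_lt; lra).
    rewrite summand_pos, sum_n_Rmult_l, <- Rmult_minus_distr_l, geom_exp_sum by (easy || lra).
    replace (3 * N - 1)%nat with (2 * N - 1 + N)%nat by lia.
    rewrite pow_add.
    set (e := exp (- (INR (S K) * t ^ N))).
    assert (He : 0 < e) by apply exp_pos.
    assert (H1 := exp_ineq1_le (t ^ N)).
    assert (H2 := exp_minus_1_pos _ Hp).
    assert (H3 : 0 <= t ^ N / (exp (t ^ N) - 1) <= 1).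
    { split; [apply Rdiv_le_0_compat; lra|].
      apply (Rmult_le_reg_r (exp (t ^ N) - 1)); [easy|].
      unfold Rdiv; rewrite Rmult_assoc, Rinv_l; lra. }
    replace (t ^ (2 * N - 1) * t ^ N * (e / (exp (t ^ N) - 1)))
      with (t ^ (2 * N - 1) * e * (t ^ N / (exp (t ^ N) - 1))) by (field; lra).
    rewrite Rabs_pos_eq.
    + rewrite <- (Rmult_1_r (t ^ (2 * N - 1) * e)) at 2.
      apply Rmult_le_compat_l; [|lra]; apply Rmult_le_pos; lra.
    + apply Rmult_le_pos; [apply Rmult_le_pos|]; lra. }
assert (H0 : summand_int 0 = 0) by apply (RInt_point (V := R_CompleteNormedModule)).
assert (Hsum : forall a b : nat -> R, sum_n (fun k => a k - b k) K = sum_n a K - sum_n b K :> R).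
{ intros a b; rewrite (sum_n_ext _ (fun k => a k + -1 * b k))
    by (intros k; real_eq; ring).
  rewrite sum_n_Rplus, sum_n_Rmult_l; ring. }
rewrite (Hsum (fun k => A (INR (S k)) T) (fun k => A (INR (S k)) 0)).
match type of H with Rabs ?e <= _ =>
  replace (summand_int T - _) with e by (rewrite H0; ring) end.
eapply Rle_trans; [exact H|].
unfold D; rewrite (pow_i N) by lia; rewrite Rmult_0_r, Ropp_0, exp_0.
specialize (HS K); set (k := INR (S K)) in *.
assert (Hi : 0 < / INR N <= 1).
{ split; [apply Rinv_0_lt_compat; lra|rewrite <- Rinv_1; apply Rinv_le_contravar; lra]. }
assert (Hk : 0 < / k ^ 2) by (apply Rinv_0_lt_compat; nra).
assert (HD : 0 <= exp (- (k * T ^ N)) * (T ^ N / k + 1 / k ^ 2)).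
{ apply Rmult_le_pos; [left; apply exp_pos|].
  assert (HTN : 0 <= T ^ N) by now apply pow_le.
  apply Rplus_le_le_0_compat; apply Rdiv_le_0_compat; nra. }
replace (0 / k + 1 / k ^ 2) with (/ k ^ 2) by (field; lra).
set (X := exp _ * _) in *; nra.
Qed.

(** The bound is uniform in k. With u = T^N >= 1, the constant 30 is 6 * 5, from exp (- u) <= 6 /
    u^3 and a polynomial factor at most 5 u^2. *)
Lemma A_decay (k T : R) : 1 <= k -> 1 <= T -> Rabs (A k T) <= 30 / T.
Proof.
intros Hk HT; unfold A.
assert (HN1 : 1 <= INR N) by (apply (le_INR 1); lia).
assert (Hu : T <= T ^ N) by (rewrite <- (pow_1 T) at 1; apply Rle_pow; [lra|easy]).
set (u := T ^ N) in *.
assert (Hi : 0 < / INR N <= 1).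
{ split; [apply Rinv_0_lt_compat; lra|rewrite <- Rinv_1; apply Rinv_le_contravar; lra]. }
assert (He : 0 < exp (- (k * u)) <= 6 / u ^ 3).
{ split; [apply exp_pos|].
  apply Rle_trans with (exp (- u)).
  - destruct (Req_dec k 1) as [->|]; [right; f_equal; ring|].
    left; apply exp_increasing; nra.
  - assert (H3 := exp_ge_pow 2 u ltac:(lra)).
    replace (INR (fact 3)) with 6 in H3 by (simpl; ring).
    rewrite exp_Ropp; replace (6 / u ^ 3) with (/ (u ^ 3 / 6)) by (field; lra).
    apply Rinv_le_contravar; [apply Rdiv_lt_0_compat; [apply pow_lt|]; lra|].
    lra. }
assert (Hki : 0 < / k <= 1).
{ split; [apply Rinv_0_lt_compat; lra|rewrite <- Rinv_1; apply Rinv_le_contravar; lra]. }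
assert (Hkm : forall m, 0 < / k ^ m <= 1).
{ intros m; split; [apply Rinv_0_lt_compat, pow_lt; lra|rewrite <- Rinv_1].
  apply Rinv_le_contravar; [lra|apply pow_R1_Rle; lra]. }
assert (Hk2 := Hkm 2%nat); assert (Hk3 := Hkm 3%nat).
set (Q := u ^ 2 / k + 2 * u / k ^ 2 + 2 / k ^ 3).
assert (HQ : 0 <= Q <= 5 * u ^ 2).
{ unfold Q, Rdiv; split.
  - apply Rplus_le_le_0_compat; [apply Rplus_le_le_0_compat|]; apply Rmult_le_pos; nra.
  - assert (u ^ 2 * / k <= u ^ 2) by nra.
    assert (2 * u * / k ^ 2 <= 2 * u ^ 2) by nra.
    assert (2 * / k ^ 3 <= 2 * u ^ 2) by nra. lra. }
rewrite Rabs_mult, Rabs_Ropp, (Rabs_pos_eq (/ INR N)) by lra.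
rewrite Rabs_pos_eq by (apply Rmult_le_pos; lra).
assert (Hp : exp (- (k * u)) * Q <= 6 / u ^ 3 * (5 * u ^ 2)).
{ apply Rmult_le_compat; lra. }
replace (6 / u ^ 3 * (5 * u ^ 2)) with (30 / u) in Hp by (field; lra).
assert (H0 : 0 <= exp (- (k * u)) * Q) by (apply Rmult_le_pos; lra).
apply Rle_trans with (30 / u); [nra|].
apply Rmult_le_compat_l; [lra|]; apply Rinv_le_contravar; lra.
Qed.

(** Each - A(k, 0) equals 2 / (N k^3). Sum and integral are exchanged by first fixing K for the
    tails, then taking T large enough to remove the K + 1 terms at T. *)
Lemma is_lim_summand_int : is_lim summand_int p_infty (2 * zeta 3 / INR N).
Proof.
assert (HN1 : 1 <= INR N) by (apply (le_INR 1); lia).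
assert (HS : forall k, 1 <= INR (S k)) by (intros k; apply (le_INR 1); lia).
assert (Hz : zeta 3 = Series (fun n => / INR (S n) ^ 3)).
{ replace 3 with (INR 3) at 1 by (simpl; ring); apply zeta_INR. }
assert (Hex : ex_series (fun n => / INR (S n) ^ 3)).
{ apply (ex_series_dominated _ (fun n => / INR (S n) ^ 2)); [|apply ex_series_inv_sqr].
  intros n; specialize (HS n).
  rewrite Rabs_pos_eq by (left; apply Rinv_0_lt_compat, pow_lt; lra).
  apply Rinv_le_contravar; [apply pow_lt; lra|apply Rle_pow; [lra|lia]]. }
assert (HA0 : forall k, A (INR (S k)) 0 = - (2 / INR N) * / INR (S k) ^ 3).
{ intros k; specialize (HS k); unfold A; rewrite (pow_i N) by lia.
  rewrite Rmult_0_r, Ropp_0, exp_0; field; lra. }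
apply is_lim_spec; intros eps; assert (Heps := cond_pos eps).
assert (HL : is_lim_seq (fun K => 2 / INR N * sum_n (fun n => / INR (S n) ^ 3) K)
  (2 / INR N * zeta 3)).
{ rewrite Hz; apply (is_lim_seq_scal_l _ (2 / INR N) (Series _)).
  now apply is_lim_seq_sum_n. }
assert (HK : is_lim_seq (fun K => / INR (S K)) 0).
{ apply (is_lim_seq_incr_1 (fun n => / INR n) 0).
  apply (is_lim_seq_inv INR p_infty); [apply is_lim_seq_INR | easy]. }
apply is_lim_seq_spec in HL; apply is_lim_seq_spec in HK.
assert (He3 : 0 < eps / 3) by lra.
destruct (HL (mkposreal _ He3)) as [K1 HK1]; destruct (HK (mkposreal _ He3)) as [K2 HK2].
cbn [pos] in HK1, HK2.
set (K := max K1 K2).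
specialize (HK1 K ltac:(lia)); specialize (HK2 K ltac:(lia)).
exists (Rmax 1 (90 * INR (S K) / eps)); intros T HT.
assert (HT1 : 1 < T) by (eapply Rle_lt_trans; [apply Rmax_l|exact HT]).
assert (HT2 : 90 * INR (S K) / eps < T) by (eapply Rle_lt_trans; [apply Rmax_r|exact HT]).
assert (H1 := summand_int_approx K T ltac:(lra)).
assert (HSK := HS K).
assert (H1' : / INR (S K) ^ 2 <= / INR (S K)).
{ apply Rinv_le_contravar; [lra|]; rewrite <- (pow_1 (INR (S K))) at 1.
  apply Rle_pow; [lra|lia]. }
rewrite Rminus_0_r, Rabs_pos_eq in HK2 by (left; apply Rinv_0_lt_compat; lra).
assert (H2 : Rabs (sum_n (fun k => A (INR (S k)) T) K) < eps / 3).
{ apply Rle_lt_trans with (INR (S K) * (30 / T)).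
  - rewrite <- (sum_n_const K (30 / T)).
    eapply Rle_trans; [exact (norm_sum_n_m (V := R_NormedModule) _ 0 K)|].
    apply sum_n_m_le; intros k; apply A_decay; [apply HS|lra].
  - apply (Rmult_lt_reg_r T); [lra|].
    replace (INR (S K) * (30 / T) * T) with (30 * INR (S K)) by (field; lra).
    apply (Rmult_lt_compat_r eps) in HT2; [|easy].
    unfold Rdiv in HT2; rewrite Rmult_assoc, Rinv_l in HT2 by lra; lra. }
rewrite (sum_n_ext _ (fun k => A (INR (S k)) T + 2 / INR N * / INR (S k) ^ 3)) in H1.
2:{ intros k; rewrite HA0; real_eq; ring. }
rewrite sum_n_Rplus, sum_n_Rmult_l in H1.
replace (2 * zeta 3 / INR N) with (2 / INR N * zeta 3) by (field; lra).
apply Rabs_def2 in HK1; apply Rabs_def2 in H2; apply Rabs_le_between in H1.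
apply Rabs_def1; lra.
Qed.

End SummandIntegral.

(** * The logarithm of the product *)

Section LogF.

Variable N : nat.
Hypothesis HN : (1 <= N)%nat.

Definition log_term (n : nat) (x : R) : R :=
  INR (S n) ^ (2 * N - 1) * - ln (1 - exp (- (INR (S n) ^ N * x))).

Definition dlog_term (n : nat) (x : R) : R :=
  - (INR (S n) ^ (3 * N - 1) * / (exp (INR (S n) ^ N * x) - 1)).

Definition logF (x : R) : R := Series (fun n => log_term n x).

Definition dlogF (x : R) : R := Series (fun n => dlog_term n x).

(** The fourth power in exp u - 1 >= u^4 / 24 is what is needed: m^(4N) dominates m^(3N-1) m^2 since
    N >= 1. *)
Lemma dlog_term_bound (a x : R) (n : nat) : 0 < a <= x ->
  Rabs (dlog_term n x) <= 24 / a ^ 4 * / INR (S n) ^ 2.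
Proof.
intros Ha; unfold dlog_term.
assert (Hm : 1 <= INR (S n)) by (apply (le_INR 1); lia).
set (m := INR (S n)) in *.
assert (HmN : 1 <= m ^ N) by now apply pow_R1_Rle.
assert (Hu : 0 < m ^ N * a <= m ^ N * x) by nra.
assert (He := exp_minus_1_pos (m ^ N * x) ltac:(lra)).
assert (H4 := exp_ge_pow 3 (m ^ N * x) ltac:(lra)).
replace (INR (fact 4)) with 24 in H4 by (simpl; ring).
assert (Hp : 0 < m ^ (3 * N - 1)) by (apply pow_lt; lra).
rewrite Rabs_Ropp, Rabs_pos_eq
  by (apply Rmult_le_pos; [lra|left; now apply Rinv_0_lt_compat]).
assert (Ha4 : 0 < a ^ 4) by (apply pow_lt; lra).
assert (Hm2 : 0 < m ^ 2) by (apply pow_lt; lra).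
assert (H5 : m ^ (3 * N - 1) * m ^ 2 * a ^ 4 <= 24 * (exp (m ^ N * x) - 1)).
{ apply Rle_trans with ((m ^ N * x) ^ 4); [|lra].
  apply Rle_trans with ((m ^ N * a) ^ 4); [|apply pow_incr; lra].
  rewrite Rpow_mult_distr, <- pow_add, <- pow_mult.
  apply Rmult_le_compat_r; [lra|]; apply Rle_pow; [easy|lia]. }
apply (Rmult_le_reg_r (m ^ 2 * a ^ 4 * (exp (m ^ N * x) - 1))).
{ apply Rmult_lt_0_compat; [nra|easy]. }
replace (24 / a ^ 4 * / m ^ 2 * (m ^ 2 * a ^ 4 * (exp (m ^ N * x) - 1)))
  with (24 * (exp (m ^ N * x) - 1)) by (field; lra).
replace (m ^ (3 * N - 1) * / (exp (m ^ N * x) - 1) * (m ^ 2 * a ^ 4 * (exp (m ^ N * x) - 1)))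
  with (m ^ (3 * N - 1) * m ^ 2 * a ^ 4) by (field; lra).
exact H5.
Qed.

(** With w = 1 / (exp u - 1) one has - ln (1 - exp (- u)) = ln (1 + w) <= w. *)
Lemma log_term_bound (x : R) (n : nat) : 0 < x ->
  Rabs (log_term n x) <= Rabs (dlog_term n x).
Proof.
intros Hx; unfold log_term, dlog_term.
assert (Hm : 1 <= INR (S n)) by (apply (le_INR 1); lia).
set (m := INR (S n)) in *.
assert (HmN : 1 <= m ^ N) by now apply pow_R1_Rle.
set (u := m ^ N * x).
assert (Hu : 0 < u) by (unfold u; nra).
assert (He := exp_minus_1_pos u Hu).
rewrite Rabs_Ropp, !Rabs_mult.
apply Rmult_le_compat; try apply Rabs_pos.
- rewrite !Rabs_pos_eq by (apply pow_le; lra); apply Rle_pow; [easy|lia].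
- assert (Hv : 1 - exp (- u) = / (1 + / (exp u - 1))).
  { rewrite exp_Ropp; field; lra. }
  assert (Hw : 0 < / (exp u - 1)) by now apply Rinv_0_lt_compat.
  rewrite Hv, ln_Rinv, Ropp_involutive by lra.
  rewrite (Rabs_pos_eq (/ _)) by lra.
  set (w := / (exp u - 1)) in *.
  assert (Hl : 0 <= ln (1 + w)).
  { rewrite <- ln_1; left; apply ln_increasing; lra. }
  rewrite Rabs_pos_eq by easy.
  rewrite <- (ln_exp w) at 2.
  apply ln_le; [lra|]; apply exp_ineq1_le.
Qed.

Lemma ex_series_dlog_bound (a : R) : ex_series (fun n => 24 / a ^ 4 * / INR (S n) ^ 2).
Proof. exact (ex_series_scal_l (24 / a ^ 4) _ ex_series_inv_sqr). Qed.

Lemma ex_series_dlog_term (x : R) : 0 < x -> ex_series (fun n => dlog_term n x).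
Proof.
intros Hx; eapply ex_series_dominated; [|apply (ex_series_dlog_bound x)].
intros n; apply dlog_term_bound; lra.
Qed.

Lemma ex_series_log_term (x : R) : 0 < x -> ex_series (fun n => log_term n x).
Proof.
intros Hx; eapply ex_series_dominated; [|apply (ex_series_dlog_bound x)].
intros n; eapply Rle_trans; [now apply log_term_bound|apply dlog_term_bound; lra].
Qed.

Lemma is_derive_logF (x : R) : 0 < x -> is_derive logF x (dlogF x).
Proof.
intros Hx.
assert (Hr : 0 < x / 2) by lra.
assert (Hball : forall t, Boule x (mkposreal _ Hr) t -> x / 2 < t).
{ intros t Ht; unfold Boule in Ht; simpl in Ht; apply Rabs_def2 in Ht; lra. }
assert (Hexp : forall n t, x / 2 < t -> 0 < exp (INR (S n) ^ N * t) - 1).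
{ intros n t Ht; apply exp_minus_1_pos, Rmult_lt_0_compat; [|lra].
  apply pow_lt, lt_0_INR; lia. }
apply (is_derive_Series log_term dlog_term
  (fun n => 24 / (x / 2) ^ 4 * / INR (S n) ^ 2) x (mkposreal _ Hr)).
- apply ex_series_dlog_bound.
- intros n t Ht; apply Hball, (Hexp n) in Ht.
  unfold log_term, dlog_term.
  replace (3 * N - 1)%nat with (2 * N - 1 + N)%nat by lia; rewrite pow_add.
  set (m := INR (S n)) in *; set (mN := m ^ N) in *; set (mp := m ^ (2 * N - 1)).
  assert (Hx1 : 1 < exp (mN * t)) by lra.
  assert (Hlt : exp (- (mN * t)) < 1).
  { rewrite exp_Ropp, <- Rinv_1; apply Rinv_lt_contravar; lra. }
  auto_derive; [lra|].
  rewrite exp_Ropp; field; lra.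
- intros n t Ht; apply Hball, (Hexp n) in Ht.
  apply (ex_derive_continuous (K := R_AbsRing) (V := R_NormedModule)).
  unfold dlog_term; set (m := INR (S n)) in *; set (mN := m ^ N) in *.
  auto_derive; lra.
- intros n t Ht; apply Hball in Ht; apply dlog_term_bound; lra.
- intros t Ht; apply Hball in Ht; apply ex_series_log_term; lra.
Qed.

(** Coefficient of x^(k-1) in L': the Euler-Maclaurin term of kernel index m = N (k + 2), where (m -
    1)! [bcoef k] is the derivative of order m - 1 of [summand] at 0. The minus sign of L' turns
    (-1)^(m-1) into (-1)^m. *)
Definition dlog_coef (k : nat) : R :=
  (-1) ^ (N * (k + 2)) * kernel (N * (k + 2)) 0 * INR (fact (N * (k + 2) - 1)) * bcoef k.

Lemma dlogF_expansion (K : nat) : exists C, forall x, 0 < x ->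
  Rabs (x ^ 3 * dlogF x + 2 * zeta 3 / INR N - sum_n (fun k => dlog_coef k * x ^ (k + 2)) K)
  <= C * x ^ (K + 2).
Proof.
(* The last kernel index j + 2 is then that of the last nonzero block, so the sparse sum ends
   exactly at k = K. *)
set (j := (N * (K + 2) - 2)%nat).
assert (Hj : (j + 2 = N * (K + 2))%nat) by (unfold j; nia).
destruct (summand_d_bound N HN (j + 2)) as [c [Hc0 Hc]].
exists (kernel_sup * c * 2); intros x Hx.
assert (HN1 : 1 <= INR N) by (apply (le_INR 1); lia).
set (y := Rpower x (/ INR N)).
assert (Hy : 0 < y) by apply exp_pos.
assert (HyN : y ^ N = x).
{ rewrite <- Rpower_pow by easy; unfold y; rewrite Rpower_mult.
  replace (/ INR N * INR N) with 1 by (field; lra); now apply Rpower_1. }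
set (S := - y ^ (3 * N - 1) * dlogF x).
assert (HS : is_series (fun n => summand_d N 0 (y * INR (Datatypes.S n))) S).
{ eapply is_series_ext;
    [|exact (is_series_scal_l (- y ^ (3 * N - 1)) _ _
        (Series_correct _ (ex_series_dlog_term x Hx)))].
  intros n.
  change (- y ^ (3 * N - 1) * dlog_term n x = summand N (y * INR (Datatypes.S n))).
  assert (Hm : 0 < INR (Datatypes.S n)) by (apply lt_0_INR; lia).
  rewrite summand_pos by (easy || now apply Rmult_lt_0_compat).
  rewrite !Rpow_mult_distr, HyN, (Rmult_comm x); unfold dlog_term; ring. }
assert (Hem := euler_maclaurin (summand_d N) (summand_int N) j c
  (is_derive_summand_d N HN) (is_derive_summand_int N HN) Hc y _ S Hy Hc0
  (is_lim_summand_d N HN) (is_lim_summand_int N HN) HS).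
assert (H0 : summand_int N 0 = 0) by apply (RInt_point (V := R_CompleteNormedModule)).
assert (H1 : summand_d N 0 0 = 0).
{ unfold summand_d; simpl Derive_n; unfold summand; rewrite pow_i by lia; ring. }
set (g := fun m => (-1) ^ (m - 1) * kernel m 0 * y ^ (m - 1) * INR (fact (m - 1))).
assert (Hsum : em_sum (summand_d N) y (fun i => kernel (i + 2) 0) j 0
  = sum_n (fun k => bcoef k * g (N * (k + 2))%nat) K).
{ rewrite <- (summand_coef_sum N HN g K), <- Hj.
  replace (j + 2 - 1)%nat with (Datatypes.S j) by lia.
  rewrite sum_n_shift, (summand_coef_small N HN 0) by lia.
  rewrite Rmult_0_l, Rplus_0_l.
  apply sum_n_ext; intros i; unfold g; rewrite summand_d_0 by easy.
  replace (Datatypes.S (Datatypes.S i) - 1)%nat with (i + 1)%nat by lia.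
  replace (Datatypes.S (Datatypes.S i)) with (i + 2)%nat by lia.
  replace (Datatypes.S i) with (i + 1)%nat by lia.
  real_eq; ring. }
rewrite Hsum, H0, H1 in Hem.
assert (Hpow : forall k, y * y ^ (N * (k + 2) - 1) = x ^ (k + 2)).
{ intros k; rewrite <- HyN, <- pow_mult.
  replace (N * (k + 2))%nat with (Datatypes.S (N * (k + 2) - 1)) at 2 by nia.
  reflexivity. }
assert (HyS : x ^ 3 * dlogF x = - (y * S)).
{ unfold S; assert (H3 : x ^ 3 = y * y ^ (3 * N - 1)).
  { rewrite <- HyN, <- pow_mult.
    replace (N * 3)%nat with (Datatypes.S (3 * N - 1)) by lia; reflexivity. }
  rewrite H3; ring. }
assert (Hg : sum_n (fun k => dlog_coef k * x ^ (k + 2)) K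
  = - (y * sum_n (fun k => bcoef k * g (N * (k + 2))%nat) K)).
{ replace (- (y * sum_n (fun k => bcoef k * g (N * (k + 2))%nat) K))
    with (- y * sum_n (fun k => bcoef k * g (N * (k + 2))%nat) K) by ring.
  rewrite <- sum_n_Rmult_l; apply sum_n_ext; intros k.
  rewrite <- Hpow; unfold dlog_coef, g.
  assert (Hsg : (-1) ^ (N * (k + 2)) = - (-1) ^ (N * (k + 2) - 1)).
  { replace (N * (k + 2))%nat with (Datatypes.S (N * (k + 2) - 1)) at 1 by nia.
    simpl; ring. }
  rewrite Hsg; real_eq; ring. }
rewrite HyS, Hg.
set (T := sum_n _ K) in *.
replace (- (y * S) + 2 * zeta 3 / INR N - - (y * T))
  with (- y * (S - ((2 * zeta 3 / INR N - 0) / y - 0 / 2 + T))) by (field; lra).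
rewrite Rabs_mult, Rabs_Ropp, (Rabs_pos_eq y) by lra.
replace (kernel_sup * c * 2 * x ^ (K + 2)) with (y * (kernel_sup * c * 2 * y ^ (j + 1))).
- apply Rmult_le_compat_l; [lra|exact Hem].
- rewrite <- Hpow; replace (j + 1)%nat with (N * (K + 2) - 1)%nat by lia; ring.
Qed.

Lemma logF_expansion (K : nat) : exists c C, forall x, 0 < x ->
  Rabs (logF x - zeta 3 / (INR N * x ^ 2) - dlog_coef 0 * ln x
        - sum_n (fun k => dlog_coef (S k) * x ^ S k / INR (S k)) K - c)
  <= C * x ^ S K.
Proof.
(* Dividing the error x^(K+3) by x^3 leaves x^K, which integrates to the claimed x^(K+1). *)
destruct (dlogF_expansion (S K)) as [C HC].
assert (HN1 : 1 <= INR N) by (apply (le_INR 1); lia).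
set (Phi := fun x => logF x - zeta 3 / (INR N * x ^ 2) - dlog_coef 0 * ln x
        - sum_n (fun k => dlog_coef (S k) * x ^ S k / INR (S k)) K).
set (dPhi := fun x => dlogF x + 2 * zeta 3 / (INR N * x ^ 3) - dlog_coef 0 / x
        - sum_n (fun k => dlog_coef (S k) * x ^ k) K).
set (C' := Rabs C / INR (S K)).
assert (HK : 0 < INR (S K)) by (apply lt_0_INR; lia).
assert (Hd : forall x, 0 < x -> is_derive Phi x (dPhi x)).
{ intros x Hx; unfold Phi, dPhi.
  apply (is_derive_minus (V := R_NormedModule)
    (fun x => logF x - zeta 3 / (INR N * x ^ 2) - dlog_coef 0 * ln x)).
  - evar_last.
    + apply (is_derive_minus (V := R_NormedModule)
        (fun x => logF x - zeta 3 / (INR N * x ^ 2)) (fun x => dlog_coef 0 * ln x)).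
      * apply (is_derive_minus (V := R_NormedModule) logF
          (fun x => zeta 3 / (INR N * x ^ 2))); [now apply is_derive_logF|].
        auto_derive; [|reflexivity].
        apply Rgt_not_eq, Rmult_lt_0_compat; nra.
      * auto_derive; [easy|reflexivity].
    + unfold minus, plus, opp; cbn -[INR pow]; field; lra.
  - apply (is_derive_sum_n (fun k x => dlog_coef (S k) * x ^ S k / INR (S k)) K x
      (fun k => dlog_coef (S k) * x ^ k)); intros k _.
    apply (is_derive_ext (fun x => dlog_coef (S k) / INR (S k) * x ^ S k)).
    { intros t; unfold Rdiv; real_eq; ring. }
    evar_last.
    + apply is_derive_scal.
      apply (is_derive_pow (fun t => t) (S k) x 1), (is_derive_id (K := R_AbsRing)).
    + cbn [pred]; field; apply not_0_INR; lia. }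
assert (Hb : forall x, 0 < x -> Rabs (dPhi x) <= Rabs C * x ^ K).
{ intros x Hx; specialize (HC x Hx).
  assert (Hx3 : 0 < x ^ 3) by now apply pow_lt.
  assert (Heq : x ^ 3 * dPhi x = x ^ 3 * dlogF x + 2 * zeta 3 / INR N
    - sum_n (fun k => dlog_coef k * x ^ (k + 2)) (S K)).
  { unfold dPhi; rewrite sum_n_shift.
    rewrite (sum_n_ext (fun k => dlog_coef (S k) * x ^ (S k + 2))
      (fun k => x ^ 3 * (dlog_coef (S k) * x ^ k))).
    - rewrite sum_n_Rmult_l; simpl (x ^ (0 + 2)); field; lra.
    - intros k; replace (S k + 2)%nat with (3 + k)%nat by lia; rewrite pow_add.
      real_eq; ring. }
  rewrite <- Heq, Rabs_mult, (Rabs_pos_eq (x ^ 3)) in HC by lra.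
  replace (S K + 2)%nat with (3 + K)%nat in HC by lia; rewrite pow_add in HC.
  apply (Rmult_le_reg_l (x ^ 3)); [easy|].
  eapply Rle_trans; [exact HC|].
  assert (HxK : 0 <= x ^ K) by (apply pow_le; lra).
  assert (HCa : C <= Rabs C) by apply Rle_abs.
  replace (x ^ 3 * (Rabs C * x ^ K)) with (Rabs C * (x ^ 3 * x ^ K)) by ring.
  apply Rmult_le_compat_r; [nra|easy]. }
assert (Hg : forall t, is_derive (fun t => C' * t ^ S K) t (Rabs C * t ^ K)).
{ intros t; evar_last.
  - apply is_derive_scal.
    apply (is_derive_pow (fun t => t) (S K) t 1), (is_derive_id (K := R_AbsRing)).
  - unfold C'; cbn [pred]; field; lra. }
assert (Hinc : forall a b, 0 < a <= b ->
  Rabs (Phi b - Phi a) <= C' * b ^ S K - C' * a ^ S K).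
{ intros a b Hab.
  apply (increment_le Phi dPhi (fun t => C' * t ^ S K) (fun t => Rabs C * t ^ K)).
  - lra.
  - intros t Ht; apply Hd; lra.
  - intros t _; apply Hg.
  - intros t Ht; apply (ex_derive_continuous (K := R_AbsRing) (V := R_NormedModule)).
    eexists; apply Hd; lra.
  - intros t Ht; apply (ex_derive_continuous (K := R_AbsRing) (V := R_NormedModule)).
    eexists; apply Hg.
  - intros t Ht; apply Hb; lra. }
assert (HC'0 : 0 <= C').
{ unfold C'; apply Rdiv_le_0_compat; [apply Rabs_pos|easy]. }
(* The limit at 0+ is the supremum of the lower bounds [Phi - C' x ^ (K + 1)]. *)
assert (Hcross : forall a b, 0 < a -> 0 < b ->
  Phi a - C' * a ^ S K <= Phi b + C' * b ^ S K).
{ intros a b Ha Hb'.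
  assert (Ha0 : 0 <= C' * a ^ S K) by (apply Rmult_le_pos; [easy|apply pow_le; lra]).
  assert (Hb0 : 0 <= C' * b ^ S K) by (apply Rmult_le_pos; [easy|apply pow_le; lra]).
  destruct (Rle_dec a b).
  - assert (H := Hinc a b ltac:(lra)); apply Rabs_le_between in H; lra.
  - assert (H := Hinc b a ltac:(lra)); apply Rabs_le_between in H; lra. }
destruct (completeness (fun v => exists a, 0 < a /\ v = Phi a - C' * a ^ S K)) as [c [Hub Hlub]].
- exists (Phi 1 + C' * 1 ^ S K); intros v [a [Ha ->]]; apply Hcross; lra.
- exists (Phi 1 - C' * 1 ^ S K), 1; split; [lra|easy].
- exists c, C'; intros x Hx.
  change (Rabs (Phi x - c) <= C' * x ^ S K).
  assert (H1 : Phi x - C' * x ^ S K <= c) by (apply Hub; now exists x).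
  assert (H2 : c <= Phi x + C' * x ^ S K).
  { apply Hlub; intros v [a [Ha ->]]; now apply Hcross. }
  apply Rabs_le; lra.
Qed.

(* The constants of the expansions of all orders agree, since the expansions
   differ by polynomials vanishing at 0. *)
Lemma logF_expansion_uniform : exists c, forall K, exists C, forall x, 0 < x <= 1 ->
  Rabs (logF x - zeta 3 / (INR N * x ^ 2) - dlog_coef 0 * ln x
        - sum_n (fun k => dlog_coef (S k) * x ^ S k / INR (S k)) K - c)
  <= C * x ^ S K.
Proof.
destruct (logF_expansion 0) as [c [C0 HC0]]; exists c; intros K.
destruct (logF_expansion K) as [c' [C' HC']].
enough (c' = c) as <- by (exists C'; intros x Hx; now apply HC').
set (p := fun x => logF x - zeta 3 / (INR N * x ^ 2) - dlog_coef 0 * ln x).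
set (a := fun m => match m with O => c' | S k => dlog_coef (S k) / INR (S k) end).
set (b := fun m => match m with O => c | S k => dlog_coef (S k) / INR (S k) end).
assert (Hsum : forall (d : R) n x,
  sum_n (fun m => match m with O => d | S k => dlog_coef (S k) / INR (S k) end * x ^ m) (S n)
  = d + sum_n (fun k => dlog_coef (S k) * x ^ S k / INR (S k)) n :> R).
{ intros d n x; rewrite sum_n_shift; simpl (x ^ 0); rewrite Rmult_1_r; f_equal.
  apply sum_n_ext; intros k; unfold Rdiv.
  real_eq; ring. }
assert (Ha : expands_upto p a 0).
{ apply (expands_upto_le _ _ 0 K); [lia|].
  apply (expands_upto_weak _ _ _ C'); intros x Hx; unfold a; rewrite Hsum.
  specialize (HC' x ltac:(lra)); fold (p x) in HC'.
  eapply Rle_trans; [|exact HC']; right; f_equal; ring. }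
assert (Hb : expands_upto p b 0).
{ apply (expands_upto_weak _ _ _ C0); intros x Hx; unfold b; rewrite Hsum.
  specialize (HC0 x ltac:(lra)); fold (p x) in HC0.
  eapply Rle_trans; [|exact HC0]; right; f_equal; ring. }
apply (expands_upto_unique p a b 0 Ha Hb); lia.
Qed.

End LogF.

(** * Identification of the coefficients *)

Lemma pow_le_fact_exp (k : nat) (t : R) : 0 <= t -> t ^ k <= INR (fact k) * exp t.
Proof.
intros Ht; destruct k as [|k].
- simpl; assert (H := exp_ineq1_le t); lra.
- assert (H := exp_ge_pow k t Ht); assert (Hf := INR_fact_lt_0 (S k)).
  apply (Rmult_le_compat_r (INR (fact (S k)))) in H; [|lra].
  unfold Rdiv in H; rewrite Rmult_assoc, Rinv_l, Rmult_1_r in H by lra; lra.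
Qed.

Lemma is_lim_pow_exp (k : nat) : is_lim (fun t => t ^ k * exp (- t)) p_infty 0.
Proof.
apply (is_lim_inv_sqr_bound _ (INR (fact k) + INR (fact (k + 2)))); intros t Ht.
assert (H1 := pow_le_fact_exp k t Ht); assert (H2 := pow_le_fact_exp (k + 2) t Ht).
rewrite pow_add in H2.
assert (He := exp_pos t); assert (Hp : 0 <= t ^ k) by now apply pow_le.
rewrite Rabs_pos_eq by (apply Rmult_le_pos; [easy|left; apply exp_pos]).
apply (Rmult_le_reg_r ((1 + t ^ 2) * exp t)); [nra|].
rewrite exp_Ropp.
replace (t ^ k * / exp t * ((1 + t ^ 2) * exp t)) with (t ^ k + t ^ k * t ^ 2)
  by (field; lra).
replace ((INR (fact k) + INR (fact (k + 2))) / (1 + t ^ 2) * ((1 + t ^ 2) * exp t))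
  with ((INR (fact k) + INR (fact (k + 2))) * exp t) by (field; nra).
lra.
Qed.

(** Repeated integration by parts of t^n exp (- t), normalised to vanish at infinity. *)
Fixpoint gamma_primitive (n : nat) (t : R) : R :=
  match n with
  | O => - exp (- t)
  | S m => - (t ^ S m * exp (- t)) + INR (S m) * gamma_primitive m t
  end.

Lemma is_derive_gamma_primitive (n : nat) (t : R) :
  is_derive (gamma_primitive n) t (t ^ n * exp (- t)).
Proof.
induction n as [|n IH].
- simpl; auto_derive; trivial; ring.
- evar_last.
  + apply (is_derive_plus (V := R_NormedModule) (fun t => - (t ^ S n * exp (- t)))
      (fun t => INR (S n) * gamma_primitive n t)).
    * apply (is_derive_opp (V := R_NormedModule) (fun t => t ^ S n * exp (- t))).
      apply (is_derive_mult (K := R_AbsRing) (fun t => t ^ S n) (fun t => exp (- t)) t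
        (INR (S n) * 1 * t ^ n) (- exp (- t))); [| |intros; apply Rmult_comm].
      -- apply (is_derive_pow (fun t => t) (S n) t 1), (is_derive_id (K := R_AbsRing)).
      -- auto_derive; trivial; ring.
    * apply is_derive_scal, IH.
  + change (- (INR (S n) * 1 * t ^ n * exp (- t) + t ^ S n * - exp (- t))
      + INR (S n) * (t ^ n * exp (- t)) = t ^ S n * exp (- t)); ring.
Qed.

Lemma gamma_primitive_0 (n : nat) : gamma_primitive n 0 = - INR (fact n).
Proof.
induction n as [|n IH]; [simpl; rewrite Ropp_0, exp_0; ring|].
cbn [gamma_primitive]; rewrite IH, fact_simpl, mult_INR, pow_i by lia; ring.
Qed.

Lemma is_lim_gamma_primitive (n : nat) : is_lim (gamma_primitive n) p_infty 0.
Proof.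
induction n as [|n IH].
- apply (is_lim_ext (fun t => -1 * (t ^ 0 * exp (- t)))); [intros t; simpl; ring|].
  evar_last; [apply is_lim_scal_l, is_lim_pow_exp|simpl; f_equal; ring].
- apply (is_lim_ext (fun t => -1 * (t ^ S n * exp (- t)) + INR (S n) * gamma_primitive n t)).
  { intros t; cbn [gamma_primitive]; ring. }
  replace (Finite 0) with (Finite (-1 * 0 + INR (S n) * 0)) by (f_equal; ring).
  apply is_lim_plus'.
  + apply (is_lim_scal_l _ (-1) p_infty 0), is_lim_pow_exp.
  + apply (is_lim_scal_l _ (INR (S n)) p_infty 0), IH.
Qed.

Lemma Gamma_INR (n : nat) : Gamma (INR (S n)) = INR (fact n).
Proof.
unfold Gamma; apply (is_RInt_gen_unique (V := R_CompleteNormedModule)).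
apply (is_RInt_gen_ext (Derive (gamma_primitive n))).
(* [Rpower] agrees with the integer power only for positive arguments, so both endpoints are kept
   positive. *)
- apply (Filter_prod _ _ _ (fun a => 0 < a) (fun b => 0 < b)).
  + exists (mkposreal 1 Rlt_0_1); now intros a _ Ha.
  + now exists 0.
  + intros a b Ha Hb t Ht; simpl in Ht.
    assert (H0 := Rmin_glb_lt a b 0 Ha Hb).
    rewrite (is_derive_unique _ _ _ (is_derive_gamma_primitive n t)).
    rewrite S_INR; replace (INR n + 1 - 1) with (INR n) by ring.
    rewrite Rpower_pow by lra; reflexivity.
- replace (INR (fact n)) with (0 - gamma_primitive n 0) by (rewrite gamma_primitive_0; ring).
  apply is_RInt_gen_Derive.
  + apply filter_forall; intros ab t _; eexists; apply is_derive_gamma_primitive.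
  + apply filter_forall; intros ab t _.
    apply (continuous_ext (fun t => t ^ n * exp (- t))).
    { intros s; symmetry; apply is_derive_unique, is_derive_gamma_primitive. }
    apply (ex_derive_continuous (K := R_AbsRing) (V := R_NormedModule)).
    auto_derive; trivial.
  + assert (Hc : continuous (gamma_primitive n) 0).
    { apply (ex_derive_continuous (K := R_AbsRing) (V := R_NormedModule)).
      eexists; apply is_derive_gamma_primitive. }
    intros P HP; change (locally 0 (fun t => 0 < t -> P (gamma_primitive n t))).
    apply (filter_imp (fun t => P (gamma_primitive n t))); [easy|exact (Hc P HP)].
  + exact (is_lim_gamma_primitive n).
Qed.

(** * Parity and closed forms of the coefficients *)

Lemma pow_m1_even (k : nat) : Nat.Even k -> (-1) ^ k = 1.
Proof. intros [m ->]; rewrite pow_mult; replace ((-1) ^ 2) with 1 by ring; apply pow1. Qed.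

Lemma pow_m1_odd (k : nat) : Nat.Odd k -> (-1) ^ k = -1.
Proof.
intros [m ->]; rewrite pow_add, (pow_m1_even (2 * m)) by (now exists m); ring.
Qed.

Lemma dlog_coef_0 (N : nat) : (1 <= N)%nat ->
  dlog_coef N 0 = bernoulli (2 * N) / INR (2 * N).
Proof.
intros HN; rewrite bernoulli_bcoef; unfold dlog_coef.
replace (N * (0 + 2))%nat with (2 * N)%nat by lia.
rewrite pow_m1_even by (now exists N).
assert (Hb : bcoef (2 * N) = kernel (2 * N) 0).
{ unfold bcoef; destruct (2 * N)%nat as [|[|m]] eqn:Heq; [lia|lia|easy]. }
rewrite Hb.
replace (fact (2 * N)) with (2 * N * fact (2 * N - 1))%nat.
- rewrite (mult_INR (2 * N)); simpl (bcoef 0); field; apply not_0_INR; lia.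
- replace (2 * N)%nat with (S (2 * N - 1)) at 1 3 by lia; apply eq_sym, fact_simpl.
Qed.

Lemma dlog_coef_odd (N i : nat) : Nat.Odd N -> dlog_coef N (2 * i + 1) = 0.
Proof.
intros [n ->]; unfold dlog_coef.
replace ((2 * n + 1) * (2 * i + 1 + 2))%nat
  with (2 * ((2 * n + 1) * (i + 1) + n) + 1)%nat by lia.
rewrite kernel_odd_0; ring.
Qed.

(** The kernel of index 2M, with M = N (j + 1), and [bcoef (2 * j)] are both zeta values. Their
    signs multiply to -1, because M + j + 2 is odd when N is odd. *)
Lemma dlog_coef_even (N j : nat) : Nat.Odd N -> (1 <= j)%nat ->
  dlog_coef N (2 * j) / INR (2 * j) = - delta N j.
Proof.
intros HN Hj; unfold dlog_coef, delta.
assert (HN1 : (1 <= N)%nat) by (destruct HN; lia).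
set (M := (N * (j + 1))%nat).
replace (N * (2 * j + 2))%nat with (2 * M)%nat by (unfold M; lia).
replace (2 * N + 2 * N * j)%nat with (2 * M)%nat by (unfold M; lia).
assert (HM : (1 <= M)%nat) by (unfold M; nia).
assert (Hb : bcoef (2 * j) = kernel (2 * j) 0).
{ unfold bcoef; destruct (2 * j)%nat as [|[|m]] eqn:Heq; [lia|lia|easy]. }
assert (HG : Gamma (INR (2 * M)) = INR (fact (2 * M - 1))).
{ replace (2 * M)%nat with (S (2 * M - 1)) at 1 by lia; apply Gamma_INR. }
rewrite Hb, HG, !kernel_even_0, pow_m1_even by (now exists M).
assert (Hsign : (-1) ^ (M + 1) * (-1) ^ (j + 1) = -1).
{ rewrite <- pow_add; apply pow_m1_odd; destruct HN as [n ->].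
  exists (n * (j + 1) + j + 1)%nat; unfold M; lia. }
replace (((2 * PI) ^ (N + 1)) ^ (2 * j)) with ((2 * PI) ^ (2 * N * j) * (2 * PI) ^ (2 * j))
  by (rewrite <- pow_add, <- pow_mult; f_equal; lia).
replace ((2 * PI) ^ (2 * M)) with ((2 * PI) ^ (2 * N) * (2 * PI) ^ (2 * N * j))
  by (rewrite <- pow_add; f_equal; unfold M; lia).
assert (HP := PI_RGT_0).
assert (Hp : forall k, (2 * PI) ^ k <> 0) by (intros k; apply pow_nonzero; lra).
assert (Hj0 : INR j <> 0) by (apply not_0_INR; lia).
rewrite (mult_INR 2 j); simpl (INR 2).
set (z1 := zeta _); set (z2 := zeta _); set (f := INR (fact _)).
transitivity (((-1) ^ (M + 1) * (-1) ^ (j + 1)) * (2 * f * z1 * z2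
  / ((2 * PI) ^ (2 * N) * INR j * ((2 * PI) ^ (2 * N * j) * (2 * PI) ^ (2 * j))))).
- field; repeat split; (apply Hp || easy || lra).
- rewrite Hsign; ring.
Qed.

Lemma sum_n_pairs (f : nat -> R) (n : nat) :
  sum_n f (2 * n + 1) = sum_n (fun i => f (2 * i)%nat + f (2 * i + 1)%nat) n :> R.
Proof.
induction n as [|n IH].
- simpl (2 * 0 + 1)%nat; now rewrite sum_n_S, !sum_O.
- replace (2 * S n + 1)%nat with (S (S (2 * n + 1))) by lia.
  rewrite !sum_n_S, IH.
  replace (2 * S n)%nat with (S (2 * n + 1)) by lia.
  replace (S (2 * n + 1) + 1)%nat with (S (S (2 * n + 1))) by lia; ring.
Qed.

Lemma logF_delta_expansion (N : nat) : Nat.Odd N ->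
  exists c, forall r, exists K, forall x, 0 < x <= 1 ->
  Rabs (logF N x - (c + bernoulli (2 * N) / INR (2 * N) * ln x + zeta 3 / (INR N * x ^ 2)
        - sum_n_m (fun j => delta N j * x ^ (2 * j)) 1 (r + 1)))
  <= K * x ^ (2 * r + 4).
Proof.
intros HN; assert (HN1 : (1 <= N)%nat) by (destruct HN; lia).
destruct (logF_expansion_uniform N HN1) as [c Hc]; exists c; intros r.
(* This order reaches x^(2r+4), the order of the error itself; the surplus term in delta_(r+2) is
   absorbed into the constant. *)
destruct (Hc (2 * (r + 1) + 1)%nat) as [K HK].
exists (K + Rabs (delta N (r + 2))); intros x Hx; specialize (HK x Hx).
rewrite dlog_coef_0 in HK by easy.
replace (S (2 * (r + 1) + 1)) with (2 * r + 4)%nat in HK by lia.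
set (d := fun j => delta N j * x ^ (2 * j)) in *.
assert (Hsum : sum_n (fun k => dlog_coef N (S k) * x ^ S k / INR (S k)) (2 * (r + 1) + 1)
  = - (sum_n_m d 1 (r + 1) + d (r + 2)%nat)).
{ rewrite sum_n_pairs.
  rewrite (sum_n_ext _ (fun i => -1 * d (S i))).
  - rewrite sum_n_Rmult_l.
    replace (sum_n (fun i => d (S i)) (r + 1)) with (sum_n_m d 1 (S (r + 1)))
      by (symmetry; apply sum_n_m_S).
    rewrite sum_n_Sm by lia.
    replace (S (r + 1)) with (r + 2)%nat by lia.
    unfold plus; simpl; ring.
  - intros i; unfold d.
    replace (S (2 * i)) with (2 * i + 1)%nat by lia; rewrite dlog_coef_odd by easy.
    replace (S (2 * i + 1)) with (2 * S i)%nat by lia.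
    assert (H := dlog_coef_even N (S i) HN ltac:(lia)).
    transitivity (dlog_coef N (2 * S i) / INR (2 * S i) * x ^ (2 * S i)).
    + unfold Rdiv; real_eq; ring.
    + rewrite H; real_eq; ring. }
rewrite Hsum in HK.
match type of HK with Rabs ?e <= _ =>
  match goal with |- Rabs ?e' <= _ => replace e' with (e - d (r + 2)%nat) by ring end end.
eapply Rle_trans; [apply Rabs_triang|].
rewrite Rabs_Ropp, Rmult_plus_distr_r; apply Rplus_le_compat; [exact HK|].
unfold d; rewrite Rabs_mult; replace (2 * (r + 2))%nat with (2 * r + 4)%nat by lia.
rewrite (Rabs_pos_eq (x ^ _)) by (apply pow_le; lra); lra.
Qed.

(** * The infinite product *)

(** [lim] is specified only up to closeness for Cauchy filters, so the value is identified by
    separatedness of C. The shift in [u] skips the empty product. *)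
Lemma lim_RtoC (u : nat -> C) (v : nat -> R) (l : R) :
  (forall n, u (S n) = RtoC (v n)) -> is_lim_seq v l ->
  @lim C_R_CompleteNormedModule (filtermap u eventually) = RtoC l.
Proof.
intros Huv Hv.
set (Fl := filtermap u eventually).
assert (HFl : ProperFilter Fl) by (apply filtermap_proper_filter, eventually_filter).
assert (Hball : forall eps : posreal, Fl (@ball C_R_CompleteNormedModule (RtoC l) eps)).
{ intros eps; apply is_lim_seq_spec in Hv; destruct (Hv eps) as [n0 Hn0].
  exists (S n0); intros n Hn; destruct n as [|n]; [lia|].
  rewrite Huv; split; simpl.
  - exact (Hn0 n ltac:(lia)).
  - exact (ball_center (0 : R_UniformSpace) eps). }
apply (eq_close (K := R_AbsRing) (V := C_R_NormedModule)).
apply (is_filter_lim_close (F := Fl)).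
- intros P [eps HP].
  apply (filter_imp (@ball C_R_CompleteNormedModule
    (@lim C_R_CompleteNormedModule Fl) eps)); [exact HP|].
  apply (complete_cauchy (T := C_R_CompleteNormedModule)); [easy|]; intros e; exists (RtoC l); apply Hball.
- intros P [eps HP].
  apply (filter_imp (@ball C_R_CompleteNormedModule (RtoC l) eps)); [exact HP|apply Hball].
Qed.

Lemma F_logF (N : nat) (q : R) : (1 <= N)%nat -> 0 < q < 1 ->
  F N (RtoC q) = RtoC (exp (logF N (- ln q))).
Proof.
intros HN Hq; set (x := - ln q).
assert (Hx : 0 < x).
{ unfold x; assert (H := ln_increasing q 1 ltac:(lra) ltac:(lra)); rewrite ln_1 in H; lra. }
assert (Hqx : forall k, q ^ k = exp (- (INR k * x))).
{ intros k; replace (- (INR k * x)) with (INR k * ln q) by (unfold x; ring).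
  rewrite exp_INR_mult, exp_ln by lra; reflexivity. }
unfold F, Cprod_inf.
apply (lim_RtoC _ (fun n => exp (sum_n (fun k => log_term N k x) n))).
- assert (Hterm : forall k, (1 / (1 - RtoC q ^ (S k ^ N)) ^ (S k ^ (2 * N - 1)))%C
    = RtoC (exp (log_term N k x))).
  { intros k.
    assert (Hm : 1 <= INR (S k)) by (apply (le_INR 1); lia).
    assert (Hlt : exp (- (INR (S k ^ N) * x)) < 1).
    { rewrite <- exp_0; apply exp_increasing; rewrite pow_INR.
      assert (0 < INR (S k) ^ N) by (apply pow_lt; lra); nra. }
    rewrite <- RtoC_pow, <- RtoC_minus, <- RtoC_pow, <- RtoC_div
      by (apply pow_nonzero; rewrite Hqx; lra).
    f_equal; rewrite Hqx; unfold log_term; rewrite pow_INR in *.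
    rewrite <- (pow_INR (S k) (2 * N - 1)), exp_INR_mult, (exp_Ropp (ln _)), exp_ln by lra.
    rewrite pow_inv; unfold Rdiv; ring. }
  induction n as [|n IH].
  + cbn [Cprod]; rewrite Hterm, sum_O; apply Cmult_1_l.
  + rewrite sum_n_S, exp_plus, RtoC_mult, <- IH, <- Hterm; reflexivity.
- apply (is_lim_seq_continuous exp _ (logF N x)).
  + apply continuity_pt_filterlim, continuous_exp.
  + apply is_lim_seq_sum_n; now apply ex_series_log_term.
Qed.

(** Used to cancel the phase of the principal power against the imaginary part of c. *)
Lemma Cexp_plus_real (a b t : R) :
  (Cexp (a, (- t)%R) * Cexp (b, t))%C = RtoC (exp (a + b)).
Proof.
unfold Cexp, Cmult, RtoC; simpl; rewrite exp_plus, cos_neg, sin_neg.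
f_equal; [|ring].
transitivity (exp a * exp b * ((sin t)² + (cos t)²)); [unfold Rsqr; ring|].
rewrite sin2_cos2; ring.
Qed.

Lemma exp_minus_1_bound (e : R) : Rabs e <= 1 -> Rabs (exp e - 1) <= 3 * Rabs e.
Proof.
intros He; replace (exp e - 1) with (exp e - exp 0) by (rewrite exp_0; ring).
replace (Rabs e) with (Rabs (e - 0)) by (f_equal; ring).
apply (increment_abs_le exp exp); [intros t _; apply is_derive_exp|].
intros t Ht; rewrite Rabs_pos_eq by (left; apply exp_pos).
eapply Rle_trans; [|apply exp_le_3].
apply Rabs_le_between in He.
assert (Hmax : Rmax 0 e <= 1) by (apply Rmax_lub; lra).
destruct (Req_dec t 1) as [->|]; [lra|left; apply exp_increasing; lra].
Qed.

Theorem corollary2p9 (N : nat) (hN : Nat.Odd N) :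
  exists c : C, forall r : nat, exists E : R -> C,
    is_bigO (at_left 1) E (fun q => ln q ^ (2 * r + 4)) /\
    at_left 1 (fun q : R =>
      F N (RtoC q) =
        (Cexp c
         * Cpower (RtoC (ln q)) (RtoC (bernoulli (2 * N) / INR (2 * N))%R)
         * RtoC (exp (zeta 3 / (INR N * ln q ^ 2)))%R
         * RtoC (exp (- sum_n_m (fun j => delta N j * ln q ^ (2 * j)) 1 (r + 1)))%R
         * (1 + E q))%C).
Proof.
assert (HN1 : (1 <= N)%nat) by (destruct hN; lia).
destruct (logF_delta_expansion N hN) as [c0 Hc0].
set (b := bernoulli (2 * N) / INR (2 * N)) in *.
(* acos (-1) is the argument that [Carg] assigns to a negative real. *)
exists (c0, - (b * acos (-1))); intros r.
destruct (Hc0 r) as [K HK].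
set (err := fun x => logF N x - (c0 + b * ln x + zeta 3 / (INR N * x ^ 2)
  - sum_n_m (fun j => delta N j * x ^ (2 * j)) 1 (r + 1))) in *.
(* With this E the identity is exact for all 0 < q < 1; only the bound on E is asymptotic. *)
exists (fun q => RtoC (exp (err (- ln q)) - 1)).
assert (Heven : forall k q, (- ln q) ^ (2 * k) = ln q ^ (2 * k)).
{ intros k q; rewrite !pow_mult; f_equal; ring. }
assert (Hln : forall q, 0 < q < 1 -> 0 < - ln q).
{ intros q Hq; assert (H := ln_increasing q 1 ltac:(lra) ltac:(lra)); rewrite ln_1 in H; lra. }
split.
- exists (3 * Rabs K).
  (* For x < d the expansion applies, as x <= 1, and |K| x <= 1, so that |err| <= 1 as
     [exp_minus_1_bound] requires. *)
  set (d := Rmin 1 (/ (Rabs K + 1))).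
  assert (HK0 := Rabs_pos K).
  assert (Hd : 0 < d) by (apply Rmin_glb_lt; [lra|apply Rinv_0_lt_compat; lra]).
  assert (He : exp (- d) < 1) by (rewrite <- exp_0; apply exp_increasing; lra).
  assert (Hpos : 0 < 1 - exp (- d)) by lra.
  exists (mkposreal _ Hpos); intros q Hq Hq1.
  assert (Hq' : Rabs (q - 1) < 1 - exp (- d)) by exact Hq.
  apply Rabs_def2 in Hq'; assert (Hp := exp_pos (- d)).
  assert (Hx := Hln q ltac:(lra)).
  assert (Hxd : - ln q < d).
  { assert (H := ln_increasing (exp (- d)) q Hp ltac:(lra)); rewrite ln_exp in H; lra. }
  assert (Hd1 : d <= 1) by apply Rmin_l.
  assert (Hd2 : d <= / (Rabs K + 1)) by apply Rmin_r.
  set (x := - ln q) in *.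
  assert (Herr : Rabs (err x) <= Rabs K * x ^ (2 * r + 4)).
  { eapply Rle_trans; [exact (HK x ltac:(lra))|].
    apply Rmult_le_compat_r; [apply pow_le; lra|apply Rle_abs]. }
  assert (Hx1 : x ^ (2 * r + 4) <= x).
  { rewrite <- (pow_1 x) at 2; apply pow_le_pow; [lra|lia]. }
  assert (Hsmall : Rabs (err x) <= 1).
  { eapply Rle_trans; [exact Herr|].
    apply Rle_trans with (Rabs K * / (Rabs K + 1)).
    - apply Rmult_le_compat_l; lra.
    - apply (Rmult_le_reg_r (Rabs K + 1)); [lra|].
      rewrite Rmult_assoc, Rinv_l; lra. }
  rewrite Cmod_R.
  replace (ln q ^ (2 * r + 4)) with (x ^ (2 * r + 4)).
  + rewrite (Rabs_pos_eq (x ^ _)) by (apply pow_le; lra).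
    eapply Rle_trans; [now apply exp_minus_1_bound|]; lra.
  + unfold x; replace (2 * r + 4)%nat with (2 * (r + 2))%nat by lia; apply Heven.
- exists (mkposreal 1 Rlt_0_1); intros q Hq Hq1.
  assert (Hq' : Rabs (q - 1) < 1) by exact Hq.
  apply Rabs_def2 in Hq'.
  assert (Hx := Hln q ltac:(lra)).
  rewrite F_logF by (easy || lra).
  set (x := - ln q) in *.
  assert (Hpow : Cpower (RtoC (ln q)) (RtoC b) = Cexp (b * ln x, b * acos (-1))).
  { unfold Cpower, Clog, Carg; rewrite Cmod_R; simpl.
    destruct (Rle_dec 0 0) as [_|]; [|lra].
    rewrite Rabs_left by (unfold x in Hx; lra); fold x.
    replace (ln q / x) with (-1) by (unfold x; field; unfold x in Hx; lra).
    f_equal; unfold Cmult, RtoC; simpl; f_equal; ring. }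
  rewrite Hpow, Cexp_plus_real.
  rewrite <- RtoC_plus, <- !RtoC_mult; f_equal.
  replace (1 + (exp (err x) - 1)) with (exp (err x)) by ring.
  rewrite <- !exp_plus; f_equal.
  assert (H2 : ln q ^ 2 = x ^ 2) by (symmetry; apply (Heven 1%nat q)).
  rewrite H2; unfold err.
  rewrite (sum_n_m_ext (fun j => delta N j * ln q ^ (2 * j))
    (fun j => delta N j * x ^ (2 * j))) by (intros j; unfold x; now rewrite Heven).
  ring.
Qed.
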